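(* Let a program of the cooperative scheduling language CoopWhile be given, with procedure table $\overline M$ and main block $s_{main}$, and assume that it has no infinite local computation. Let $f^{init}$ be the task identifier of the main block and let $C^{init}=(K^{f^{init}}(s_{main}),\mathrm{create}())$ be the initial scheduler configuration (empty queue). Then the scheduler defined by the transition relation $\to_S$ (rules (S1)--(S7)) is a quiescent fair scheduler for CoopWhile: if $$\langle\sigma_\varepsilon\rangle,\,C^{init}\ \to_S\ sh_1,\,C_1\ \to_S\ sh_2,\,C_2\ \to_S\ \cdots$$ is a (finite or infinite) scheduler execution, then there is a quiescent fair execution in the (non-deterministic) semantics $\to$ (rules (C1)--(C2)) of the form $$\langle\sigma_\varepsilon\rangle,\,\{K^{f^{init}}(s_{main})\}\ \to^*\ \mathrm M(sh_1),\,\mathrm M(C_1)\ \to^*\ \mathrm M(sh_2),\,\mathrm M(C_2)\ \to^*\ \cdots ,$$ i.e. one that produces the same trace up to $doneEv$ events. Here $\to^*$ is the reflexive transitive closure of $\to$.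
   Context: **Syntax.** Statements: $s ::= \mathsf{skip}\mid v:=e\mid \mathsf{if}\ e\,\{s\}\mid s;s\mid \mathsf{while}\ e\,\{s\}\mid \mathsf{spawn}(m,e,x)\mid \mathsf{suspend}\mid \mathsf{await}\ x\mid \mathsf{return}$, where $\mathsf{return}$ does not occur in source programs but only at runtime. Expressions are side-effect free and well-typed, so evaluation never gets stuck. A program consists of a finite set $\overline M$ of procedure declarations $m(x)\{s\}$ (a name $m$, one local parameter $x$, a body $s$; one declaration per name) and a main block $s_{main}$. Spawned procedures are declared; task identifier variables are initialised before use. Sequential composition is taken up to associativity. $\bot$ denotes the empty statement; $\bot;s$ is always rewritten to $s$. $TId$ is the set of task identifiers. **States and traces.** A symbolic state $\sigma$ is a partial map from variables to symbolic expressions (expressions or the unknown value $*$). Variables $X$ with $\sigma(X)=*$ are symbolic; $\mathrm{symb}(\sigma)$ is their set; $\sigma$ is concrete if $\mathrm{symb}(\sigma)=\emptyset$. $\sigma[x\mapsto e]$ is update, and $\sigma\subseteq\sigma'$ means $\sigma'$ extends $\sigma$ as a map. $\mathrm{val}_\sigma(e)$ evaluates expressions as usual, with $\mathrm{val}_\sigma(X)=X$ for symbolic $X$. A trace is a finite or infinite sequence of states and event markers ($\varepsilon$ empty trace, $\tau\frown t$ appending an element, $\cdot$ concatenation, $\langle\sigma\rangle=\varepsilon\frown\sigma$). $\mathrm{last}(\tau)$ is the final state and $\mathrm{lastEvent}(\tau)$ the last event marker in $\tau$. A path condition $pc$ is a finite set of Boolean expressions; once fully evaluated it is consistent if it does not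 contain false. $pc\triangleright\tau$ is a conditioned trace. For an event $ev(\bar e)$, a state $\sigma$ and a set $\overline V$ of fresh symbolic variables, $ev_\sigma^{\overline V}(\bar e)=\langle\sigma\rangle\frown ev(\mathrm{val}_{\sigma'}(\bar e))\frown\sigma'$ with $\sigma'=\sigma[\overline V\mapsto *]$; $\overline V$ is omitted if empty. Chop: if $\tau_1=\tau\frown\sigma$ is finite, $\tau_2=\langle\sigma'\rangle\cdot\tau'$ and $\sigma\subseteq\sigma'$, then $\tau_1 ** \tau_2=\tau\cdot\tau_2$. A concretisation mapping $\rho$ from variables to values for a state $\sigma$ satisfies $\mathrm{dom}(\rho)\cap\mathrm{dom}(\sigma)=\mathrm{symb}(\sigma)$; $\rho(\sigma)$ is the concrete state obtained by binding every symbolic variable $X$ of $\sigma$ to $\rho(X)$ and evaluating all expressions accordingly. This extends elementwise to events, traces and path conditions; ''$\rho$ concretizes $\tau$'' means $\rho$ is a concretisation mapping for the states of $\tau$ giving values to all its symbolic variables. $\sigma_\varepsilon$ is the state initialising all program variables to $0$. **Events and well-formedness.** Events: $callEv(v,m,f)$, $callREv(v,m,f)$, $compEv(f)$, $compREv(f)$, and the auxiliary scheduler event $doneEv$. Well-formedness $wf$: $wf(\varepsilon)$ holds; $wf(sh\frown\sigma)=wf(sh)$; $wf(sh\frown doneEv)=wf(sh)$; $wf(sh\frown callEv(v,m,f))$ iff $wf(sh)$ and no $callEv(v',m',f)$ occurs in $sh$ for any $v',m'$; $wf(sh\frown callREv(v,m,f))$ iff $wf(sh)$, $callEv(v,m,f)\in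 sh$ and $callREv(v,m,f)\notin sh$; $wf(sh\frown compEv(f))=wf(sh)$; $wf(sh\frown compREv(f))$ iff $wf(sh)$ and $compEv(f)\in sh$. **Local evaluation.** For a task identifier $F$, $\mathrm{val}^F_\sigma(s)$ is a set of items $pc\triangleright\tau\cdot K(s')$, where $s'$ is the remaining statement (continuation): - $\mathrm{val}^F_\sigma(\bot)=\emptyset$; $\mathrm{val}^F_\sigma(\mathsf{skip})=\{\emptyset\triangleright\langle\sigma\rangle\cdot K(\bot)\}$; $\mathrm{val}^F_\sigma(\mathsf{suspend})=\{\emptyset\triangleright\langle\sigma\rangle\cdot K(\bot)\}$; - $\mathrm{val}^F_\sigma(x:=e)=\{\emptyset\triangleright\langle\sigma\rangle\frown\sigma[x\mapsto\mathrm{val}_\sigma(e)]\cdot K(\bot)\}$; - $\mathrm{val}^F_\sigma(\mathsf{if}\ e\{s\})=\{\{\mathrm{val}_\sigma(e)\}\triangleright\langle\sigma\rangle\cdot K(s),\ \{\mathrm{val}_\sigma(!e)\}\triangleright\langle\sigma\rangle\cdot K(\bot)\}$; - $\mathrm{val}^F_\sigma(r;s)=\{pc\triangleright\tau\cdot K(r';s)\mid pc\triangleright\tau\cdot K(r')\in\mathrm{val}^F_\sigma(r)\}$; - $\mathrm{val}^F_\sigma(\mathsf{while}\ e\{s\})=\mathrm{val}^F_\sigma(\mathsf{if}\ e\{s;\mathsf{while}\ e\{s\}\})$; - $\mathrm{val}^F_\sigma(\mathsf{spawn}(m,e,x))=\{\emptyset\triangleright callEv_\sigma^{\{F'\}}(\mathrm{val}_\sigma(e),m,F')\frown\sigma[x\mapsto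 F',F'\mapsto *]\cdot K(\bot)\mid F'\notin\mathrm{dom}(\sigma)\}$; - $\mathrm{val}^F_\sigma(m(x)\{s\})=\{\emptyset\triangleright callREv_\sigma^{\{X\}}(X,m,F)\frown\sigma[x'\mapsto X,X\mapsto *]\cdot K(s[x\leftarrow x'];\mathsf{return})\mid x',X\notin\mathrm{dom}(\sigma)\}$; - $\mathrm{val}^F_\sigma(\mathsf{return})=\{\emptyset\triangleright compEv_\sigma(F)\cdot K(\bot)\}$; $\mathrm{val}^F_\sigma(\mathsf{await}\ x)=\{\emptyset\triangleright compREv_\sigma(\mathrm{val}_\sigma(x))\cdot K(\bot)\}$. A statement is suspended, $\mathrm{suspended}(s)$, if it has the form $\mathsf{await}\ x;s'$ or $\mathsf{suspend};s'$ ($s'$ possibly empty). **Non-deterministic semantics $\to$.** Configurations are $sh,P$ with $sh$ a concrete trace and $P$ a multiset of continuations $K^f(s)$ tagged with task identifiers; $K^f(\bot)$ is always deleted. $Q$ always denotes a (possibly empty) multiset all of whose statements are suspended; at most one element of $P$ is not suspended (the active task). (C1) If $\sigma=\mathrm{last}(sh)$, $pc\triangleright\tau\cdot K(s')\in\mathrm{val}^f_\sigma(s)$, $\rho$ concretizes $\tau$, $\rho(pc)$ is consistent and $wf(sh**\rho(\tau))$, then $sh,\,Q\uplus\{K^f(s)\}\to sh**\rho(\tau),\,Q\uplus\{K^f(s')\}$. (C2) If $m(x)\{s\}\in\overline M$, $\sigma=\mathrm{last}(sh)$, $f\in TId$, $pc\triangleright\tau\cdot K(s')\in\mathrm{val}^f_\sigma(m(x)\{s\})$,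 $\rho$ concretizes $\tau$, $\rho(pc)$ is consistent and $wf(sh**\rho(\tau))$, then $sh,\,Q\to sh**\rho(\tau),\,Q\uplus\{K^f(s')\}$. **Fairness.** A configuration is quiescent if it has the form $sh,Q$ (no active task). For $C=(sh,P)\to C'=(sh',P')$, $\mathrm{newStmt}(C,C')=P'-P$ (multiset difference), and $\mathrm{enabled}(C)$ is the multiset of all continuations in $\mathrm{newStmt}(C,C')$ over all $C'$ with $C\to C'$. An infinite execution $C_0\to C_1\to\cdots$ is quiescent fair if for all $m$ and all $K^f(s)$: if for every $n>m$ ($C_n$ quiescent implies $K^f(s)\in\mathrm{enabled}(C_n)$), then there is $n'>m$ with $K^f(s)\in\mathrm{newStmt}(C_{n'},C_{n'+1})$. Fairness imposes no requirement on finite (terminating or stuck) executions. A program has no infinite local computation if, in every infinite $\to$-execution from its initial configuration $\langle\sigma_\varepsilon\rangle,\{K^{f^{init}}(s_{main})\}$, every stage $m$ is followed by a stage $n>m$ that is quiescent. **Scheduler $\to_S$.** Queues are FIFO: $\mathrm{create}()$ is the empty queue, $\mathrm{push}(q,k)$ adds $k$ at the rear, $\mathrm{pop}(q)=(q',k)$ returns the first element $k$ and the rest $q'$ (undefined if empty), and $\mathrm{rotate}(q)=\mathrm{push}(q',k)$ for $(q',k)=\mathrm{pop}(q)$. Scheduler configurations are $sh,(act,q)$ where $act$ is $\mathrm{Idle}$ or a continuation $K^f(s)$, and $q$ is a queue whose elements are suspended continuations $K^f(s)$ or task markers $(m,f)$. Let (N) be the condition: $\mathrm{lastEvent}(sh)$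 is not of the form $callEv(v,m,f')$. (S1) If $\mathrm{lastEvent}(sh)=callEv(v,m,f)$: $sh,(act,q)\to_S sh**doneEv_\sigma,(act,\mathrm{push}(q,(m,f)))$ with $\sigma=\mathrm{last}(sh)$. (S2) If (N), $\sigma=\mathrm{last}(sh)$, $\mathrm{pop}(q)=(q',(m,f))$, $m(x)\{s\}\in\overline M$, $pc\triangleright\tau\cdot K(s')\in\mathrm{val}^f_\sigma(m(x)\{s\})$, $\rho$ concretizes $\tau$, $\rho(pc)$ consistent, $wf(sh**\rho(\tau))$: $sh,(\mathrm{Idle},q)\to_S sh**\rho(\tau),(K^f(s'),q')$. (S3) If (N), $\sigma=\mathrm{last}(sh)$, $\mathrm{pop}(q)=(q',K^f(s))$, $pc\triangleright\tau\cdot K(s')\in\mathrm{val}^f_\sigma(s)$, $\rho$ concretizes $\tau$, $\rho(pc)$ consistent, $wf(sh**\rho(\tau))$: $sh,(\mathrm{Idle},q)\to_S sh**\rho(\tau),(K^f(s'),q')$. (S4) If (N), $\sigma=\mathrm{last}(sh)$, $\mathrm{pop}(q)=(q',K^f(s))$, $s=\mathsf{await}\ x;s'$ and $compEv(\sigma(x))\notin sh$: $sh,(\mathrm{Idle},q)\to_S sh,(\mathrm{Idle},\mathrm{rotate}(q))$. (S5) If (N), $\sigma=\mathrm{last}(sh)$, not $\mathrm{suspended}(s)$, $pc\triangleright\tau\cdot K(s')\in\mathrm{val}^f_\sigma(s)$, $\rho$ concretizes $\tau$, $\rho(pc)$ consistent, $wf(sh**\rho(\tau))$: $sh,(K^f(s),q)\to_S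 sh**\rho(\tau),(K^f(s'),q)$. (S6) If (N): $sh,(K^f(\bot),q)\to_S sh,(\mathrm{Idle},q)$. (S7) If (N) and $\mathrm{suspended}(s)$: $sh,(K^f(s),q)\to_S sh,(\mathrm{Idle},\mathrm{push}(q,K^f(s)))$. **Translation M.** For a queue $q$, $\mathrm M^0(q)$ is the multiset of continuations $K^f(s)$ in $q$, ignoring task markers $(m,f)$. $\mathrm M((act,q))=\mathrm M^0(q)$ if $act=\mathrm{Idle}$ or $act=K^f(\bot)$, and $\mathrm M((act,q))=\mathrm M^0(q)\uplus\{act\}$ otherwise. For a trace $sh$, $\mathrm M(sh)$ is $sh$ with all $doneEv$ events removed (each together with the repeated copy of the state introduced by appending the event). *)

(* Defs.v *)
From Stdlib Require List.
From HB Require Import structures.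
From mathcomp Require Import all_boot.
From mathcomp Require Import finmap multiset boolp.

Set Implicit Arguments.
Unset Strict Implicit.
Unset Printing Implicit Defensive.

Local Open Scope fset_scope.
Local Open Scope fmap_scope.
Local Open Scope mset_scope.

(* The expression language is a parameter.  Operators are interpreted by total
   functions, so that evaluation never gets stuck; a partially defined typed
   language is covered by completing its operators arbitrarily. *)
Record exprLang := ExprLang {
  value : Type;
  tid : Type;
  of_tid : tid -> value;
  of_tid_inj : injective of_tid;
  vzero : value;
  vtrue : value;
  vfalse : value;
  vtrue_neq_vfalse : vtrue <> vfalse;
  op : Type;
  opsem : op -> seq value -> value;
  opnot : op;
  opnot_true : opsem opnot [:: vtrue] = vfalse;
  opnot_false : opsem opnot [:: vfalse] = vtrue
}.

Definition var := nat.
Definition pname := nat.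

Section Language.
Context {L : exprLang}.

Inductive expr :=
  | ELit of value L
  | EVar of var
  | EOp of op L & seq expr.

(* The syntactic types get their eqType and choiceType structures classically. *)
HB.instance Definition _ := gen_eqMixin expr.
HB.instance Definition _ := gen_choiceMixin expr.

Definition enot (e : expr) := EOp (opnot L) [:: e].

(* A statement is a list of instructions: sequential composition is
   concatenation and the empty statement is the empty list, so that statements
   are taken up to associativity and [⊥; s] is [s]. *)
Inductive instr :=
  | Skip
  | Assign of var & expr
  | If of expr & seq instr
  | While of expr & seq instr
  | Spawn of pname & expr & var
  | Suspend
  | Await of var
  | Return.

Definition stmt := seq instr.

Record proc := Proc { pparam : var; pbody : stmt }.

Record program := Program {
  procs : {fmap pname -> proc};
  main_block : stmt
}.

(* Source statements: no [Return], and no empty statement or block. *)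
Fixpoint source_instr (i : instr) : bool :=
  match i with
  | If _ b | While _ b => ~~ nilp b && all source_instr b
  | Return => false
  | _ => true
  end.

Definition source_stmt (s : stmt) : bool := ~~ nilp s && all source_instr s.

Fixpoint spawns_in (D : {fset pname}) (i : instr) : bool :=
  match i with
  | If _ b | While _ b => all (spawns_in D) b
  | Spawn m _ _ => m \in D
  | _ => true
  end.

Definition wf_stmt (D : {fset pname}) (s : stmt) : bool :=
  source_stmt s && all (spawns_in D) s.

Definition wf_program (p : program) : Prop :=
  wf_stmt (domf (procs p)) (main_block p) /\
  forall m d, (procs p).[? m] = Some d -> wf_stmt (domf (procs p)) (pbody d).

Fixpoint expr_vars (e : expr) : seq var :=
  match e with
  | ELit _ => [::]
  | EVar x => [:: x]
  | EOp _ es => flatten (map expr_vars es)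
  end.

Fixpoint instr_vars (i : instr) : seq var :=
  match i with
  | Assign x e => x :: expr_vars e
  | If e b | While e b => expr_vars e ++ flatten (map instr_vars b)
  | Spawn _ e x => x :: expr_vars e
  | Await x => [:: x]
  | Skip | Suspend | Return => [::]
  end.

Definition stmt_vars (s : stmt) : seq var := flatten (map instr_vars s).

Definition proc_vars (d : proc) : seq var := pparam d :: stmt_vars (pbody d).

Definition prog_vars (p : program) : {fset var} :=
  [fset x in stmt_vars (main_block p) ++
             flatten [seq proc_vars (procs p m) | m <- enum {: domf (procs p)}]].

Definition ren (x x' y : var) : var := if y == x then x' else y.

Fixpoint expr_subst (x x' : var) (e : expr) : expr :=
  match e with
  | ELit v => ELit v
  | EVar y => EVar (ren x x' y)
  | EOp o es => EOp o (map (expr_subst x x') es)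
  end.

Fixpoint instr_subst (x x' : var) (i : instr) : instr :=
  match i with
  | Skip => Skip
  | Assign y e => Assign (ren x x' y) (expr_subst x x' e)
  | If e b => If (expr_subst x x' e) (map (instr_subst x x') b)
  | While e b => While (expr_subst x x' e) (map (instr_subst x x') b)
  | Spawn m e y => Spawn m (expr_subst x x' e) (ren x x' y)
  | Suspend => Suspend
  | Await y => Await (ren x x' y)
  | Return => Return
  end.

Definition stmt_subst (x x' : var) (s : stmt) : stmt :=
  map (instr_subst x x') s.

Definition lit_of (e : expr) : option (value L) :=
  if e is ELit v then Some v else None.

(* Variables on which [r] is undefined are left unevaluated, and an operator is
   applied once all its arguments are values. *)
Fixpoint eval (r : var -> option expr) (e : expr) : expr :=
  match e with
  | ELit v => ELit v
  | EVar x => odflt (EVar x) (r x)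
  | EOp o es =>
      let es' := map (eval r) es in
      if all (fun a => isSome (lit_of a)) es' then ELit (opsem o (pmap lit_of es'))
      else EOp o es'
  end.

Inductive sexpr := Known of expr | Star.

Definition sstate := {fmap var -> sexpr}.

(* Concrete states have their own type: every variable is bound to a value. *)
Definition cstate := {fmap var -> value L}.

Definition sym_of (s : cstate) : sstate := [fmap x : domf s => Known (ELit (s x))].

Definition is_star (a : option sexpr) : bool := if a is Some Star then true else false.

Definition symb (s : sstate) : {fset var} := [fset x in domf s | is_star s.[? x]].

Definition sval (s : sstate) (e : expr) : expr :=
  eval (fun x => if s.[? x] is Some (Known e') then Some e' else None) e.

(* [event A T]: arguments in [A], task identifiers in [T].  Concrete events
   carry genuine task identifiers, symbolic ones carry expressions. *)
Inductive event (A T : Type) :=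
  | CallEv of A & pname & T
  | CallREv of A & pname & T
  | CompEv of T
  | CompREv of T
  | DoneEv.
Arguments CompEv {A T} _.
Arguments CompREv {A T} _.
Arguments DoneEv {A T}.

Definition event_map A T A' T' (f : A -> A') (g : T -> T') (ev : event A T) :
    event A' T' :=
  match ev with
  | CallEv a m t => CallEv (f a) m (g t)
  | CallREv a m t => CallREv (f a) m (g t)
  | CompEv t => CompEv (g t)
  | CompREv t => CompREv (g t)
  | DoneEv => DoneEv
  end.

Inductive titem (S E : Type) := St of S | Ev of E.
Arguments St {S E} _.
Arguments Ev {S E} _.

HB.instance Definition _ S E := gen_eqMixin (titem S E).

Definition sevent := event expr expr.
Definition cevent := event (value L) (tid L).

(* Only finite traces occur in configurations. *)
Definition strace := seq (titem sstate sevent).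
Definition ctrace := seq (titem cstate cevent).

Definition last_state (sh : ctrace) : option cstate :=
  ohead (rev (pmap (fun a => if a is St s then Some s else None) sh)).

Definition last_event (sh : ctrace) : option cevent :=
  ohead (rev (pmap (fun a => if a is Ev e then Some e else None) sh)).

Definition ev_trace (s : sstate) (V : {fset var}) (ev : sevent) : strace :=
  let s' := s + [fmap x : V => Star] in
  [:: St s; Ev (event_map (sval s') (sval s') ev); St s'].

Definition extends (s s' : cstate) : Prop :=
  forall x, x \in domf s -> s'.[? x] = s.[? x].

Inductive chop : ctrace -> ctrace -> ctrace -> Prop :=
  | Chop t s s' t' : extends s s' ->
      chop (rcons t (St s)) (St s' :: t') (t ++ St s' :: t').

Definition cmap := {fmap var -> value L}.

Definition conc_expr (rho : cmap) (e : expr) : option (value L) :=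
  lit_of (eval (fun x => omap ELit rho.[? x]) e).

Definition conc_sexpr (rho : cmap) (x : var) (a : sexpr) : option (value L) :=
  match a with
  | Known e => conc_expr rho e
  | Star => rho.[? x]
  end.

(* [s'] is [rho(s)], and [rho] is a concretisation mapping for [s]. *)
Definition conc_state (rho : cmap) (s : sstate) (s' : cstate) : Prop :=
  [/\ (domf rho `&` domf s)%fset = symb s,
      domf s' = domf s &
      forall x, s'.[? x] = obind (conc_sexpr rho x) s.[? x]].

Definition conc_tid (rho : cmap) (e : expr) (f : tid L) : Prop :=
  conc_expr rho e = Some (of_tid f).

Definition conc_event (rho : cmap) (ev : sevent) (ev' : cevent) : Prop :=
  match ev, ev' with
  | CallEv e m t, CallEv v m' f | CallREv e m t, CallREv v m' f =>
      [/\ conc_expr rho e = Some v, m = m' & conc_tid rho t f]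
  | CompEv t, CompEv f | CompREv t, CompREv f => conc_tid rho t f
  | DoneEv, DoneEv => True
  | _, _ => False
  end.

Definition conc_item (rho : cmap) (a : titem sstate sevent)
    (a' : titem cstate cevent) : Prop :=
  match a, a' with
  | St s, St s' => conc_state rho s s'
  | Ev ev, Ev ev' => conc_event rho ev ev'
  | _, _ => False
  end.

Definition concretises (rho : cmap) : strace -> ctrace -> Prop :=
  List.Forall2 (conc_item rho).

Definition consistent (rho : cmap) (pc : {fset expr}) : Prop :=
  forall e, e \in pc -> exists2 v, conc_expr rho e = Some v & v <> vfalse L.

Inductive wf : ctrace -> Prop :=
  | WfNil : wf [::]
  | WfState sh s : wf sh -> wf (rcons sh (St s))
  | WfDone sh : wf sh -> wf (rcons sh (Ev DoneEv))
  | WfCall sh v m f : wf sh ->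
      (forall v' m', Ev (CallEv v' m' f) \notin sh) ->
      wf (rcons sh (Ev (CallEv v m f)))
  | WfCallR sh v m f : wf sh ->
      Ev (CallEv v m f) \in sh -> Ev (CallREv v m f) \notin sh ->
      wf (rcons sh (Ev (CallREv v m f)))
  | WfComp sh f : wf sh -> wf (rcons sh (Ev (CompEv f)))
  | WfCompR sh f : wf sh -> Ev (CompEv f) \in sh ->
      wf (rcons sh (Ev (CompREv f))).

(* [val_stmt F s r pc t r'] means that the item [pc ▷ t · K(r')] belongs to
   [val^F_s(r)]; similarly for [val_instr] and [val_proc]. *)
Inductive val_instr (F : tid L) (s : sstate) :
    instr -> {fset expr} -> strace -> stmt -> Prop :=
  | ValSkip : val_instr F s Skip fset0 [:: St s] [::]
  | ValSuspend : val_instr F s Suspend fset0 [:: St s] [::]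
  | ValAssign x e :
      val_instr F s (Assign x e) fset0
        [:: St s; St s.[x <- Known (sval s e)]] [::]
  | ValIfTrue e b : val_instr F s (If e b) [fset sval s e] [:: St s] b
  | ValIfFalse e b : val_instr F s (If e b) [fset sval s (enot e)] [:: St s] [::]
  | ValWhile e b pc t r :
      val_instr F s (If e (b ++ [:: While e b])) pc t r ->
      val_instr F s (While e b) pc t r
  | ValSpawn m e x F' : F' \notin domf s ->
      val_instr F s (Spawn m e x) fset0
        (rcons (ev_trace s [fset F'] (CallEv (sval s e) m (EVar F')))
               (St s.[x <- Known (EVar F')].[F' <- Star])) [::]
  | ValReturn :
      val_instr F s Return fset0
        (ev_trace s fset0 (CompEv (ELit (of_tid F)))) [::]
  | ValAwait x :
      val_instr F s (Await x) fset0
        (ev_trace s fset0 (CompREv (sval s (EVar x)))) [::].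

Inductive val_stmt (F : tid L) (s : sstate) :
    stmt -> {fset expr} -> strace -> stmt -> Prop :=
  | ValSeq i r pc t i' : val_instr F s i pc t i' ->
      val_stmt F s (i :: r) pc t (i' ++ r).

Inductive val_proc (F : tid L) (s : sstate) (m : pname) (d : proc) :
    {fset expr} -> strace -> stmt -> Prop :=
  | ValProc x' X : x' \notin domf s -> X \notin domf s ->
      val_proc F s m d fset0
        (rcons (ev_trace s [fset X] (CallREv (EVar X) m (ELit (of_tid F))))
               (St s.[x' <- Known (EVar X)].[X <- Star]))
        (stmt_subst (pparam d) x' (pbody d) ++ [:: Return]).

(* The premises common to all rules which extend the trace [sh] to
   [sh' = sh ** rho(t)], for an item [pc ▷ t · K(r)] of the local evaluation
   [V] in the last state of [sh]. *)
Definition realises (V : sstate -> {fset expr} -> strace -> stmt -> Prop)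
    (sh sh' : ctrace) (r : stmt) : Prop :=
  exists (s : cstate) (pc : {fset expr}) (t : strace) (rho : cmap) (t' : ctrace),
    [/\ last_state sh = Some s, V (sym_of s) pc t r,
        concretises rho t t' /\ consistent rho pc,
        chop sh t' sh' & wf sh'].

Definition suspended (r : stmt) : bool :=
  if r is (Await _ | Suspend) :: _ then true else false.

Record cont := Cont { owner : tid L; code : stmt }.

HB.instance Definition _ := gen_eqMixin cont.
HB.instance Definition _ := gen_choiceMixin cont.

(* The singleton multiset, where [K^f(⊥)] is deleted. *)
Definition kont (f : tid L) (r : stmt) : {mset cont} :=
  if r is [::] then mset0 else [mset Cont f r].

Definition all_suspended (Q : {mset cont}) : Prop :=
  forall k, k \in Q -> suspended (code k).

Definition cconfig := (ctrace * {mset cont})%type.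

Inductive cstep (p : program) : cconfig -> cconfig -> Prop :=
  | C1 sh sh' Q f r r' : all_suspended Q ->
      realises (fun s => val_stmt f s r) sh sh' r' ->
      cstep p (sh, Q `+` [mset Cont f r]) (sh', Q `+` kont f r')
  | C2 sh sh' Q f m d r' : all_suspended Q ->
      (procs p).[? m] = Some d ->
      realises (fun s => val_proc f s m d) sh sh' r' ->
      cstep p (sh, Q) (sh', Q `+` kont f r').

Definition quiescent (C : cconfig) : Prop := all_suspended C.2.

Definition new_stmt (C C' : cconfig) : {mset cont} := C'.2 `\` C.2.

(* Membership in the (possibly infinite) multiset of enabled continuations. *)
Definition enabled (p : program) (C : cconfig) (k : cont) : Prop :=
  exists2 C', cstep p C C' & k \in new_stmt C C'.

Inductive activity := Idle | Active of cont.
Inductive qelem := QCont of cont | QTask of pname & tid L.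

Definition queue := seq qelem.
Definition create : queue := [::].
Definition push (q : queue) (k : qelem) : queue := rcons q k.
Definition pop (q : queue) : option (queue * qelem) :=
  if q is k :: q' then Some (q', k) else None.
Definition rotate (q : queue) : option queue :=
  omap (fun qk => push qk.1 qk.2) (pop q).

Definition sconfig := (ctrace * (activity * queue))%type.

Definition no_pending_call (sh : ctrace) : Prop :=
  forall v m f, last_event sh <> Some (CallEv v m f).

(* [compEv(s(x))] occurs in [sh]. *)
Definition completed (sh : ctrace) (s : cstate) (x : var) : Prop :=
  exists2 f, s.[? x] = Some (of_tid f) & Ev (CompEv f) \in sh.

Inductive sstep (p : program) : sconfig -> sconfig -> Prop :=
  | S1 sh sh' s act q v m f :
      last_event sh = Some (CallEv v m f) -> last_state sh = Some s ->
      chop sh [:: St s; Ev DoneEv; St s] sh' ->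
      sstep p (sh, (act, q)) (sh', (act, push q (QTask m f)))
  | S2 sh sh' q q' m f d r' : no_pending_call sh ->
      pop q = Some (q', QTask m f) -> (procs p).[? m] = Some d ->
      realises (fun s => val_proc f s m d) sh sh' r' ->
      sstep p (sh, (Idle, q)) (sh', (Active (Cont f r'), q'))
  | S3 sh sh' q q' f r r' : no_pending_call sh ->
      pop q = Some (q', QCont (Cont f r)) ->
      realises (fun s => val_stmt f s r) sh sh' r' ->
      sstep p (sh, (Idle, q)) (sh', (Active (Cont f r'), q'))
  | S4 sh s q q' q'' f x r : no_pending_call sh -> last_state sh = Some s ->
      pop q = Some (q', QCont (Cont f (Await x :: r))) ->
      ~ completed sh s x -> rotate q = Some q'' ->
      sstep p (sh, (Idle, q)) (sh, (Idle, q''))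
  | S5 sh sh' q f r r' : no_pending_call sh -> ~~ suspended r ->
      realises (fun s => val_stmt f s r) sh sh' r' ->
      sstep p (sh, (Active (Cont f r), q)) (sh', (Active (Cont f r'), q))
  | S6 sh q f : no_pending_call sh ->
      sstep p (sh, (Active (Cont f [::]), q)) (sh, (Idle, q))
  | S7 sh q f r : no_pending_call sh -> suspended r ->
      sstep p (sh, (Active (Cont f r), q)) (sh, (Idle, push q (QCont (Cont f r)))).

Definition M_queue (q : queue) : {mset cont} :=
  seq_mset (pmap (fun a => if a is QCont k then Some k else None) q).

Definition M_sched (c : activity * queue) : {mset cont} :=
  if c.1 is Active k then M_queue c.2 `+` kont (owner k) (code k) else M_queue c.2.

(* The state following [DoneEv] is the repeated copy of the one preceding it. *)
Fixpoint M_trace (sh : ctrace) : ctrace :=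
  match sh with
  | Ev DoneEv :: St _ :: sh' => M_trace sh'
  | Ev DoneEv :: sh' => M_trace sh'
  | a :: sh' => a :: M_trace sh'
  | [::] => [::]
  end.

Definition M_config (c : sconfig) : cconfig := (M_trace c.1, M_sched c.2).

(* Its domain is finite, so that fresh variables exist in every reachable state. *)
Definition sigma_eps (p : program) : cstate :=
  [fmap x : prog_vars p => vzero L].

Definition cinit (p : program) (finit : tid L) : cconfig :=
  ([:: St (sigma_eps p)], kont finit (main_block p)).

Definition sinit (p : program) (finit : tid L) : sconfig :=
  ([:: St (sigma_eps p)], (Active (Cont finit (main_block p)), create)).

End Language.

(* An execution is a sequence of stages 0, 1, ..., n if [last_stage] is
   [Some n], and an infinite sequence if [last_stage] is [None]; the values of
   [stage] after the last stage are irrelevant. *)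
Record execution (C : Type) := Execution {
  stage :> nat -> C;
  last_stage : option nat
}.

Definition has_stage C (e : execution C) (i : nat) : bool :=
  if last_stage e is Some n then i <= n else true.

Definition is_execution C (step : C -> C -> Prop) (c : C) (e : execution C) : Prop :=
  e 0 = c /\ forall i, has_stage e i.+1 -> step (e i) (e i.+1).

Definition infinite C (e : execution C) : Prop := last_stage e = None.

(* Infinite, or terminated, or stuck. *)
Definition complete C (step : C -> C -> Prop) (e : execution C) : Prop :=
  forall n, last_stage e = Some n -> forall c, ~ step (e n) c.

Definition no_infinite_local_computation L (p : program) (finit : tid L) : Prop :=
  forall e, is_execution (cstep p) (cinit p finit) e -> infinite e ->
  forall m, exists2 n, m < n & quiescent (e n).

Definition quiescent_fair L (p : program) (e : execution (@cconfig L)) : Prop :=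
  infinite e ->
  forall m k, (forall n, m < n -> quiescent (e n) -> enabled p (e n) k) ->
  exists2 n, m < n & k \in new_stmt (e n) (e n.+1).

(* [d] has the form [tr (e 0) ->* tr (e 1) ->* tr (e 2) ->* ...]: the segment
   number [i] goes from stage [phi i] to stage [phi i.+1] of [d], and [d] is
   exhausted by these segments. *)
Definition passes_through C D (tr : C -> D) (e : execution C) (d : execution D) : Prop :=
  exists phi : nat -> nat,
    [/\ phi 0 = 0,
        forall i, has_stage e i.+1 -> phi i <= phi i.+1,
        forall i, has_stage e i -> has_stage d (phi i) /\ d (phi i) = tr (e i) &
        forall j, has_stage d j -> exists2 i, has_stage e i & j <= phi i].

(* Main.v *)
(* Transitions (S1), (S4), (S6) and (S7) do not change the image of a
   configuration under M, while (S2), (S3) and (S5) are mapped to transitions (C1)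
   or (C2); removing repetitions from the image of a scheduler execution thus
   yields an execution [d] of the non-deterministic semantics.

   For fairness, as there is no infinite local computation, the scheduler is idle
   infinitely often, and since the queue is FIFO each of its elements is eventually
   at the front and popped.  A continuation [K^f(r)] enabled in a quiescent
   configuration comes from a continuation [K^f(i; r)] of the queue, or from a call
   with identifier [f] which has not started yet and has its marker in the queue.
   Popping the marker starts the task, after which only the first possibility is
   left.  At most one [i] qualifies, so that when [K^f(i; r)] is popped the
   instruction [i] itself must be ready, and (S3) produces [K^f(r)].

   The same argument shows that if [d] is finite although the scheduler runs
   forever, then its last configuration is stuck. *)
From Stdlib Require List.
From HB Require Import structures.
From mathcomp Require Import all_boot.
From mathcomp Require Import finmap multiset boolp.
From mathcomp Require Import zify.
Require Import Defs.

Set Implicit Arguments.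
Unset Strict Implicit.
Unset Printing Implicit Defensive.

Local Open Scope mset_scope.
Local Open Scope fset_scope.
Local Open Scope fmap_scope.
Local Open Scope nat_scope.

Arguments St {S E} _.
Arguments Ev {S E} _.
Arguments CompEv {A T} _.
Arguments CompREv {A T} _.
Arguments DoneEv {A T}.

HB.instance Definition _ A T := gen_eqMixin (event A T).
HB.instance Definition _ (L : exprLang) := gen_eqMixin (tid L).
HB.instance Definition _ L := gen_eqMixin (@qelem L).
HB.instance Definition _ L := gen_eqMixin (@instr L).

(** * Traces *)

Section Traces.
Context {L : exprLang}.
Implicit Types (sh t w : @ctrace L) (ev : @cevent L) (s : @cstate L).

Definition events sh : seq (@cevent L) :=
  pmap (fun a => if a is Ev e then Some e else None) sh.

Definition is_done ev := if ev is DoneEv then true else false.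

(** Well-formedness and [unmatched] depend on a trace only through this sequence, so they agree on
    [sh] and [M_trace sh]. *)
Definition core sh := [seq ev <- events sh | ~~ is_done ev].

Lemma events_cat sh w : events (sh ++ w) = events sh ++ events w.
Proof. exact: pmap_cat. Qed.

Lemma core_cat sh w : core (sh ++ w) = core sh ++ core w.
Proof. by rewrite /core events_cat filter_cat. Qed.

Lemma core_rcons_St sh s : core (rcons sh (St s)) = core sh.
Proof. by rewrite -cats1 core_cat cats0. Qed.

Lemma core_rcons_Ev sh ev :
  core (rcons sh (Ev ev)) = if is_done ev then core sh else rcons (core sh) ev.
Proof. by rewrite -cats1 core_cat /core /=; case: is_done; rewrite ?cats0 ?cats1. Qed.

Lemma core_map_Ev sh : core (map Ev (core sh)) = core sh.
Proof.
rewrite {1}/core; suff -> : events (map Ev (core sh)) = core sh.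
  by rewrite /core filter_id.
by elim: (core sh) => //= ev l ->.
Qed.

Lemma mem_events sh ev : (Ev ev \in sh) = (ev \in events sh).
Proof.
rewrite mem_pmap; elim: sh => //= -[s|ev'] sh IH; rewrite !inE IH; congr orb.
  by apply/negbTE/eqP.
by apply/eqP/eqP=> [[->]|[->]].
Qed.

Lemma mem_core sh ev : ~~ is_done ev -> (ev \in core sh) = (Ev ev \in sh).
Proof. by move=> nd; rewrite mem_filter nd mem_events. Qed.

Lemma last_event_cat sh w :
  last_event (sh ++ w) = if last_event w is Some ev then Some ev else last_event sh.
Proof.
rewrite /last_event -!/(events _) events_cat rev_cat.
by case: (rev (events w)).
Qed.

Lemma last_state_rcons sh s : last_state (rcons sh (St s)) = Some s.
Proof. by rewrite /last_state -cats1 pmap_cat rev_cat. Qed.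

Definition allowed (c : seq (@cevent L)) ev : Prop :=
  match ev with
  | CallEv _ m f => forall v' m', CallEv v' m' f \notin c
  | CallREv v m f => CallEv v m f \in c /\ CallREv v m f \notin c
  | CompREv f => CompEv f \in c
  | _ => True
  end.

Lemma wf_rcons sh a :
  wf (rcons sh a) <-> wf sh /\ (if a is Ev ev then allowed (core sh) ev else True).
Proof.
split=> [h|[h]].
  (* The index becomes an equation, as the constructors of [wf] are indexed by [rcons]. *)
  have inv sh1 : wf sh1 -> forall sh0 a0, sh1 = rcons sh0 a0 ->
      wf sh0 /\ if a0 is Ev ev then allowed (core sh0) ev else True.
    case=> [|sh2 s2 h2|sh2 h2|sh2 v m f h2 hn|sh2 v m f h2 hi hn|sh2 f h2|sh2 f h2 hi]
      sh0 a0; first by case: sh0.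
    - by case/rcons_inj=> <- <-.
    - by case/rcons_inj=> <- <-.
    - by case/rcons_inj=> <- <-; split=> //= v' m'; rewrite mem_core.
    - by case/rcons_inj=> <- <-; rewrite /= !mem_core.
    - by case/rcons_inj=> <- <-.
    - by case/rcons_inj=> <- <-; rewrite /= mem_core.
  exact: inv h _ _ erefl.
case: a => [s _|[v m f|v m f|f|f|]] /=; first exact: WfState.
- by move=> hn; apply: WfCall => // v' m'; have := hn v' m'; rewrite mem_core.
- by case; rewrite !mem_core // => hi hn; apply: WfCallR.
- by move=> _; apply: WfComp.
- by rewrite mem_core // => hi; apply: WfCompR.
- by move=> _; apply: WfDone.
Qed.

Lemma wf_core sh : wf sh <-> wf (map Ev (core sh)).
Proof.
elim/last_ind: sh => // sh [s|ev] IH; rewrite wf_rcons.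
  by rewrite core_rcons_St; tauto.
rewrite core_rcons_Ev; case: ev => [v m f|v m f|f|f|] /=; rewrite ?map_rcons ?wf_rcons ?core_map_Ev /=; tauto.
Qed.

Lemma wf_eq_core sh sh' : core sh = core sh' -> wf sh -> wf sh'.
Proof. by rewrite (wf_core sh) (wf_core sh') => ->. Qed.

Lemma core_M_trace sh : core (M_trace sh) = core sh.
Proof.
(* [M_trace] inspects two elements at once, so the induction also carries the statement with one
   more element in front. *)
suff [] : core (M_trace sh) = core sh /\
          forall a, core (M_trace (a :: sh)) = core (a :: sh) by [].
have cons_Ev ev w : core (Ev ev :: w) = if is_done ev then core w else ev :: core w.
  by rewrite -cat1s core_cat /core /=; case: is_done.
have cons_St s w : core (St s :: w) = core w by [].
elim: sh => [|a sh [IH1 IH2]]; first by split=> // -[s|[]].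
split=> [|b]; first exact: IH2.
case: b => [s|[v m f|v m f|f|f|]].
- by rewrite /= cons_St IH2 cons_St.
- by rewrite /= cons_Ev IH2 cons_Ev.
- by rewrite /= cons_Ev IH2 cons_Ev.
- by rewrite /= cons_Ev IH2 cons_Ev.
- by rewrite /= cons_Ev IH2 cons_Ev.
- by case: a IH2 => [s IH2|ev IH2]; rewrite cons_Ev /= ?IH1 -?IH2.
Qed.

(** The left part has to end with a state: after a final [DoneEv], the first state of [w] would be
    taken for the repeated copy and erased. *)
Lemma M_trace_cat t s w :
  M_trace (rcons t (St s) ++ w) = M_trace (rcons t (St s)) ++ M_trace w.
Proof.
suff [] : M_trace (rcons t (St s) ++ w) = M_trace (rcons t (St s)) ++ M_trace w /\
          forall a, M_trace (a :: rcons t (St s) ++ w) =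
                    M_trace (a :: rcons t (St s)) ++ M_trace w by [].
elim: t => [|a t [IH1 IH2]] /=; first by split=> // -[s'|[]].
split=> [|b]; first exact: IH2.
case: b => [s'|[v m f|v m f|f|f|]]; try exact: (congr1 (cons _) (IH2 a)).
by case: a => [s'|ev]; [exact: IH1 | exact: (IH2 (Ev ev))].
Qed.

Lemma M_trace_id w : core w = events w -> M_trace w = w.
Proof.
rewrite /core => h; have {h} : all (fun ev => ~~ is_done ev) (events w).
  by apply/all_filterP.
elim: w => // -[s|ev] w IH /=; first by move/IH->.
by case/andP=> nd /IH IHw; case: ev nd => // *; rewrite /= IHw.
Qed.

(** A second call with identifier [f] is rejected by [wf] whatever its argument and procedure, so
    [f] determines both. *)
Lemma call_unique sh v m v' m' f : wf sh ->
  CallEv v m f \in core sh -> CallEv v' m' f \in core sh -> v = v' /\ m = m'.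
Proof.
elim/last_ind: sh => // sh a IH /wf_rcons[/IH {}IH].
case: a => [s|ev]; rewrite ?core_rcons_St // core_rcons_Ev.
case: ifP => [_ _|_ ha]; first exact: IH.
rewrite !mem_rcons !inE => /orP[/eqP e1|h1] /orP[/eqP e2|h2]; last exact: IH.
- by move: e2; rewrite -e1 => -[-> ->].
- by move: ha; rewrite -e1 => /(_ v' m'); rewrite h2.
- by move: ha; rewrite -e2 => /(_ v m); rewrite h1.
Qed.

Lemma callR_call sh v m f : wf sh ->
  CallREv v m f \in core sh -> CallEv v m f \in core sh.
Proof.
elim/last_ind: sh => // sh a IH /wf_rcons[/IH {}IH].
case: a => [s|ev]; rewrite ?core_rcons_St // core_rcons_Ev.
case: ifP => // _ ha; rewrite !mem_rcons !inE.
case/orP=> [/eqP e|/IH->]; last by rewrite orbT.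
by move: ha; rewrite -e /= => -[-> _]; rewrite orbT.
Qed.

End Traces.

(** * Local evaluation *)

Section LocalEvaluation.
Context {L : exprLang}.
Implicit Types (sh w : @ctrace L) (s : @cstate L) (f g : tid L).
Implicit Types (i : @instr L) (r : @stmt L).
Implicit Types (V : @sstate L -> {fset @expr L} -> @strace L -> @stmt L -> Prop).

(* The item [pc ▷ t · K(r)] of [V] in the last state [s] of a trace extends the
   trace by [w]: concretisation fixes the concrete state [s], so that the first
   state of the concretised [t] is the repeated copy of [s] removed by [**]. *)
Definition local V s w r : Prop :=
  exists (pc : {fset @expr L}) (t : @strace L) (rho : @cmap L),
    [/\ V (sym_of s) pc t r, concretises rho t (St s :: w) & consistent rho pc].

Definition starts_here V : Prop :=
  forall (s : @sstate L) pc (t : @strace L) r, V s pc t r -> exists t0, t = St s :: t0.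

Lemma fnd_sym_of s x : (sym_of s).[? x] = omap (fun v => Known (ELit v)) s.[? x].
Proof.
case: fndP => [xs|xs]; first by rewrite /= ffunE in_fnd.
by rewrite not_fnd.
Qed.

Lemma symb_sym_of s : symb (sym_of s) = fset0.
Proof.
apply/fsetP=> x; rewrite !inE fnd_sym_of.
by apply/negbTE; rewrite negb_and; case: (s.[? x]) => [v|] /=; rewrite orbT.
Qed.

Lemma conc_sym_of rho s s' : conc_state rho (sym_of s) s' -> s' = s.
Proof.
case=> _ _ h; apply/fmapP=> x; rewrite h fnd_sym_of.
by case: (s.[? x]).
Qed.

(** As the concretised item starts with the current state itself, chop reduces to appending [w]. *)
Lemma realisesE V sh sh' r : starts_here V ->
  realises V sh sh' r <->
  exists t s w, [/\ sh = rcons t (St s), sh' = sh ++ w, wf sh' & local V s w r].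
Proof.
move=> hV; split.
  case=> s [pc [t [rho [t' [hs Vt [ct cp] ch wf']]]]].
  case: {sh sh' t'} ch hs ct wf' => t1 s1 s2 w _.
  rewrite last_state_rcons => -[->] ct wf'.
  have [t0 et] := hV _ _ _ _ Vt; subst t.
  have e2 : s2 = s by inversion_clear ct; apply: conc_sym_of H.
  subst s2; exists t1, s, w; rewrite -cats1 -catA; split=> //.
  by exists pc, (St (sym_of s) :: t0), rho.
case=> t [s [w [-> -> wf' [pc [t0 [rho [Vt ct cp]]]]]]].
exists s, pc, t0, rho, (St s :: w); split=> //; first exact: last_state_rcons.
by rewrite -cats1 -catA cats1; apply: Chop.
Qed.

Definition sevents (t : @strace L) : seq (@sevent L) :=
  pmap (fun a => if a is Ev e then Some e else None) t.

Lemma concretises_events rho (t : @strace L) t' :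
  concretises rho t t' -> List.Forall2 (conc_event rho) (sevents t) (events t').
Proof.
elim=> [|a a' t0 t0' ha _ IH]; first by constructor.
case: a a' ha => [s1|e1] [s2|e2] //= h; by constructor.
Qed.

Lemma Forall2_1l A B (P : A -> B -> Prop) a l :
  List.Forall2 P [:: a] l -> exists2 b, l = [:: b] & P a b.
Proof. by move=> h; inversion_clear h; inversion_clear H0; exists y. Qed.

Lemma concretises_last rho (t0 : @strace L) (s0 : @sstate L) t : concretises rho (rcons t0 (St s0)) t ->
  exists t1 s1, t = rcons t1 (St s1) /\ domf s1 = domf s0.
Proof.
elim: t0 t => [|a t0 IH] [|b t] /= ct; inversion_clear ct.
  inversion H0; case: b H => // s [_ es _].
  by exists [::], s.
have [t1 [s1 [-> es]]] := IH _ H0.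
by exists (b :: t1), s1.
Qed.

Lemma sval_sym_of s x v : s.[? x] = Some v -> sval (sym_of s) (EVar x) = ELit v.
Proof. by move=> h; rewrite /sval /= fnd_sym_of h. Qed.

Lemma sval_star (s : @sstate L) x : s.[? x] = Some Star -> sval s (EVar x) = EVar x.
Proof. by move=> h; rewrite /sval /= h. Qed.

(** Collects what the invariants need of one local step: initial state, growth of the domain,
    successor code, and events. The induction serves [While], which steps as an [If]. *)
Lemma val_instr_inv f (s : @sstate L) i pc t (i' : @stmt L) : val_instr f s i pc t i' ->
  [/\ exists t0, t = St s :: t0,
      exists t1 (s1 : @sstate L), t = rcons t1 (St s1) /\ domf s `<=` domf s1,
      match i with
      | If _ b => i' = b \/ i' = [::]
      | While e b => i' = b ++ [:: While e b] \/ i' = [::]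
      | _ => i' = [::]
      end
    & match i with
      | Spawn m _ _ => exists a b, sevents t = [:: CallEv a m b]
      | Return => exists b, sevents t = [:: CompEv b]
      | Await x =>
          sevents t =
            [:: CompREv (sval (catf s [fmap y : (fset0 : {fset var}) => Star]) (sval s (EVar x)))]
      | _ => sevents t = [::]
      end].
Proof.
elim=> {i pc t i'} /=.
- by split; [exists [::] | exists [::], s | |].
- by split; [exists [::] | exists [::], s | |].
- move=> x e; split; [by eexists | | by [] | by []].
  by exists [:: St s]; eexists; split; [by [] | rewrite dom_setf fsubsetUr].
- by move=> e b; split; [exists [::] | exists [::], s | left |].
- by move=> e b; split; [exists [::] | exists [::], s | right |].
- by move=> e b pc t r _ [].
- move=> m e x F' F's; split; [by eexists | | by [] | by do 2!eexists].
  exists (ev_trace s [fset F'] (CallEv (sval s e) m (EVar F'))); eexists; split=> //.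
  by rewrite !dom_setf fsetUA fsubsetUr.
- split; [by eexists | | by [] | by eexists].
  do 2!eexists; split; first exact: (erefl (rcons [:: _; _] _)).
  by rewrite domf_cat fsubsetUl.
- move=> x; split; [by eexists | | by [] | by []].
  do 2!eexists; split; first exact: (erefl (rcons [:: _; _] _)).
  by rewrite domf_cat fsubsetUl.
Qed.

Definition local_stmt f r := local (fun s : @sstate L => val_stmt f s r).
Definition local_proc f m d := local (fun s : @sstate L => val_proc f s m d).

Lemma stmt_starts_here f r : starts_here (fun s : @sstate L => val_stmt f s r).
Proof.
by move=> s pc t r' [i r0 pc0 t0 i' /val_instr_inv[h _ _ _]].
Qed.

Lemma proc_starts_here f m d : starts_here (fun s : @sstate L => val_proc f s m d).
Proof. by move=> s pc t r' [x' X _ _]; eexists. Qed.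

(** Concrete counterpart of [val_instr_inv]. In the [Await] clause [x] must be bound: an unbound
    variable stays unevaluated, and [rho] may give it a value unknown to [s]. *)
Lemma local_stmt_inv f r s w r' : local_stmt f r s w r' ->
  exists i r0 (i' : @stmt L), [/\ r = i :: r0, r' = i' ++ r0,
      exists w1 s', St s :: w = rcons w1 (St s') /\ domf s `<=` domf s',
      match i with
      | If _ b => i' = b \/ i' = [::]
      | While e b => i' = b ++ [:: While e b] \/ i' = [::]
      | _ => i' = [::]
      end
    & match i with
      | Spawn m _ _ => exists v g, events w = [:: CallEv v m g]
      | Return => exists g, events w = [:: CompEv g]
      | Await x =>
          exists g, events w = [:: CompREv g] /\ (x \in domf s -> s.[? x] = Some (of_tid g))
      | _ => events w = [::]
      end].
Proof.
case=> pc [t [rho [Vt ct _]]]; case: {pc t r'} Vt ct => i r0 pc t i'.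
case/val_instr_inv=> _ hl hi he ct; exists i, r0, i'; split=> //.
  have [t1 [s1 [et sub]]] := hl; rewrite et in ct.
  by have [w1 [s' [-> es]]] := concretises_last ct; exists w1, s'; rewrite es.
have := concretises_events ct; rewrite /= {hi hl ct}.
case: i he => [|x e|e b|e b|m e x||x|] /=.
- by move=> -> h; inversion_clear h.
- by move=> -> h; inversion_clear h.
- by move=> -> h; inversion_clear h.
- by move=> -> h; inversion_clear h.
- move=> [a [b ->]] h; have [e' -> he] := Forall2_1l h.
  case: e' he {h} => //= v m' g [_ <- _].
  by exists v, g.
- by move=> -> h; inversion_clear h.
- move=> -> h; have [e' -> he] := Forall2_1l h.
  case: e' he {h} => //= g hg.
  exists g; split=> // xs; rewrite in_fnd.
  by move: hg; rewrite (sval_sym_of (in_fnd xs)) /conc_tid /=.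
- move=> [b ->] h; have [e' -> he] := Forall2_1l h.
  case: e' he {h} => //= g _.
  by exists g.
Qed.

Lemma conc_sym_of_refl s : conc_state fmap0 (sym_of s) s.
Proof.
split=> //; first by rewrite symb_sym_of domf0 fset0I.
by move=> x; rewrite fnd_sym_of; case: (s.[? x]).
Qed.

Lemma cat_empty s : catf (sym_of s) [fmap y : (fset0 : {fset var}) => Star] = sym_of s.
Proof.
apply/fmapP=> x; rewrite fnd_cat.
by rewrite in_fset0.
Qed.

Lemma local_suspend f s r : local_stmt f (Suspend :: r) s [::] r.
Proof.
exists fset0, [:: St (sym_of s)], fmap0; split.
- exact: (ValSeq _ (ValSuspend _ _)).
- by constructor=> //; exact: conc_sym_of_refl.
- by move=> e; rewrite inE.
Qed.

Lemma local_await f s x g r : s.[? x] = Some (of_tid g) ->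
  local_stmt f (Await x :: r) s [:: Ev (CompREv g); St s] r.
Proof.
move=> hx; eexists fset0, _, fmap0; split.
- exact: (ValSeq _ (ValAwait _ _ _)).
- rewrite /ev_trace cat_empty; constructor; first exact: conc_sym_of_refl.
  constructor; last by constructor=> //; exact: conc_sym_of_refl.
  by rewrite /= (sval_sym_of hx).
- by move=> e; rewrite inE.
Qed.

Lemma local_proc_inv f m d s w r : local_proc f m d s w r ->
  exists v x', [/\ r = stmt_subst (pparam d) x' (pbody d) ++ [:: Return],
      exists w1 s', [/\ St s :: w = rcons w1 (St s'), domf s `<=` domf s' & x' \in domf s']
    & events w = [:: CallREv v m f]].
Proof.
case=> pc [t [rho [Vt ct _]]]; case: {pc t r} Vt ct => x' X _ _ ct.
have [w1 [s' [ew es]]] := concretises_last (t0 := [:: _; _; _]) ct.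
have := concretises_events ct => h; have [e' ee he] := Forall2_1l h.
case: e' ee he {h} => //= v m' g ee [_ em [/of_tid_inj eg]]; subst m' g.
exists v, x'; split=> //; exists w1, s'; split=> //; rewrite es !dom_setf.
  by rewrite fsetUA fsubsetUr.
by rewrite !inE eqxx orbT.
Qed.

Lemma conc_star s X v : X \notin domf s ->
  conc_state [fmap].[X <- v] (catf (sym_of s) [fmap y : [fset X] => Star]) s.[X <- v].
Proof.
move: (sym_of s) (fnd_sym_of s) (erefl : domf (sym_of s) = domf s) => a ha da Xs.
have starE y : (catf a [fmap y : [fset X] => Star]).[? y] =
    if y == X then Some Star else omap (fun v => Known (ELit v)) s.[? y].
  by rewrite fnd_cat in_fset1 ha; case: eqP => // ->; rewrite (in_fnd (fset11 X)) ffunE.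
split.
- apply/fsetP=> y; rewrite !inE starE ?da.
  case: (eqVneq y X) => [->|_] /=; first by rewrite orbT.
  by case: (s.[? y]) => [?|]; rewrite andbF.
- by rewrite dom_setf domf_cat da fsetUC.
- move=> y; rewrite starE !fnd_set; case: eqP => [->|_] /=; first by rewrite fnd_set eqxx.
  by case: (s.[? y]).
Qed.

Lemma conc_bound_star s x X v : X \notin domf s ->
  conc_state [fmap].[X <- v] (sym_of s).[x <- Known (EVar X)].[X <- Star]
    s.[x <- v].[X <- v].
Proof.
move: (sym_of s) (fnd_sym_of s) (erefl : domf (sym_of s) = domf s) => a ha da Xs.
split.
- apply/fsetP=> y; rewrite !inE !fnd_set ha ?da.
  case: (eqVneq y X) => [->|_] //=; case: (eqVneq y x) => [_|_] //=.
  by case: (s.[? y]) => [?|]; rewrite andbF.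
- by rewrite !dom_setf da.
- move=> y; rewrite !fnd_set ha; case: eqP => [->|_] /=; first by rewrite fnd_set eqxx.
  case: eqP => [_|_] /=; first by rewrite /conc_expr /= fnd_set eqxx.
  by case: (s.[? y]).
Qed.

(** The symbolic argument of a started task can be concretised to any value, so the reaction can be
    matched with a given call. *)
Lemma local_proc_ex f m d s v :
  exists w r, local_proc f m d s w r /\ events w = [:: CallREv v m f].
Proof.
(* The sum of the finite domain bounds each variable in it, so its successor is fresh. *)
pose bound := (\sum_(x <- domf s) x).+1.
have freshP n : bound <= n -> n \notin domf s.
  move=> hn; apply/negP=> ns; move: hn; rewrite /bound (big_fsetD1 n ns) /=; lia.
(* The one fresh variable [X] serves both as renamed parameter and as symbolic argument. *)
have Xs := freshP bound (leqnn _); set X := bound in Xs.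
exists [:: Ev (CallREv v m f); St s.[X <- v]; St s.[X <- v].[X <- v]],
  (stmt_subst (pparam d) X (pbody d) ++ [:: Return]); split=> //.
eexists fset0, _, [fmap].[X <- v]; split; first by apply: (ValProc _ _ _ Xs Xs).
  have domr : domf ([fmap].[X <- v] : @cmap L) = [fset X] by rewrite dom_setf domf0 fsetU0.
  constructor; last constructor; last constructor; last constructor; last by [].
  - split=> //.
      rewrite domr symb_sym_of; apply/fsetP=> y; rewrite !inE.
      by case: eqP => // ->; rewrite (negbTE Xs).
    by move=> y; rewrite fnd_sym_of; case: (s.[? y]).
  - split=> //; rewrite sval_star.
      by rewrite /conc_expr /= fnd_set eqxx.
    by rewrite fnd_cat in_fset1 eqxx (in_fnd (fset11 X)) ffunE.
  - exact: conc_star.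
  - exact: conc_bound_star.
by move=> e; rewrite inE.
Qed.

End LocalEvaluation.

(** * Multisets given by sequences *)

Section MsetSeq.
Context {K : choiceType}.
Implicit Types (a : K) (l : seq K) (Q : {mset K}).

Lemma mem_seq_mset a l : (a \in seq_mset l) = (a \in l).
Proof. exact: perm_mem (perm_eq_seq_mset l) a. Qed.

Lemma seq_mset_cat l l' : seq_mset (l ++ l') = (seq_mset l `+` seq_mset l')%mset.
Proof. by apply/msetP=> a; rewrite msetE2 !mset_seqE count_cat. Qed.

Lemma seq_mset1 a : seq_mset [:: a] = [mset a]%mset.
Proof. by apply/msetP=> b; rewrite mset_seqE msetnE /= eq_sym addn0; case: eqP. Qed.

Lemma seq_mset_addr l Q a : seq_mset l = (Q `+` [mset a])%mset ->
  exists2 l', Q = seq_mset l' & perm_eq l (a :: l').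
Proof.
move=> e; have al : a \in l by rewrite -mem_seq_mset e in_msetD in_mset1 eqxx orbT.
exists (rem a l); last exact: perm_to_rem.
move/eq_seq_msetP: (perm_to_rem al) => e'.
by rewrite -[LHS](msetDKBC [mset a]%mset) -e e' -cat1s seq_mset_cat seq_mset1 msetDKB.
Qed.

End MsetSeq.

(** * Run-time code *)

Section Code.
Context {L : exprLang}.
Implicit Types (i : @instr L) (r : @stmt L) (D : {fset pname}) (X : {fset var}).

(** Blocks are lists nested inside instructions; this principle supplies the induction hypothesis
    for their elements. *)
Lemma instr_nested_ind (P : @instr L -> Prop) :
  (forall i, match i with If _ b | While _ b => List.Forall P b | _ => True end -> P i) ->
  forall i, P i.
Proof.
move=> h; fix IH 1 => i; apply: h; case: i => // _ b.
  by elim: b => [|j b IHb]; constructor.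
by elim: b => [|j b IHb]; constructor.
Qed.

Lemma expr_vars_subst x x' (e : @expr L) :
  expr_vars (expr_subst x x' e) = map (ren x x') (expr_vars e).
Proof.
move: e; fix IH 1 => -[v|y|o es] //=.
by rewrite map_flatten -!map_comp; congr flatten; elim: es => //= e es ->; rewrite IH.
Qed.

Lemma instr_vars_subst x x' i :
  instr_vars (instr_subst x x' i) = map (ren x x') (instr_vars i).
Proof.
elim/instr_nested_ind: i => -[|y e|e b|e b|m e y||y|] //= h; rewrite ?expr_vars_subst //.
  by rewrite map_cat map_flatten -!map_comp; congr (_ ++ flatten _); elim: h => //= j b' -> _ ->.
by rewrite map_cat map_flatten -!map_comp; congr (_ ++ flatten _); elim: h => //= j b' -> _ ->.
Qed.

Lemma source_instr_subst x x' i : source_instr (instr_subst x x' i) = source_instr i.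
Proof.
elim/instr_nested_ind: i => -[|y e|e b|e b|m e y||y|] //= h.
  by rewrite all_map; congr (_ && _); [case: b {h} | elim: h => //= j b' -> _ ->].
by rewrite all_map; congr (_ && _); [case: b {h} | elim: h => //= j b' -> _ ->].
Qed.

Lemma spawns_in_subst D x x' i : spawns_in D (instr_subst x x' i) = spawns_in D i.
Proof.
elim/instr_nested_ind: i => -[|y e|e b|e b|m e y||y|] //= h.
  by rewrite all_map; elim: h => //= j b' -> _ ->.
by rewrite all_map; elim: h => //= j b' -> _ ->.
Qed.

Definition ok_instr D X i : bool :=
  [&& source_instr i, spawns_in D i & all (mem X) (instr_vars i)].

Lemma ok_instr_subst D X x x' i : x' \in X ->
  ok_instr D X i -> ok_instr D X (instr_subst x x' i).
Proof.
move=> x'X; rewrite /ok_instr source_instr_subst spawns_in_subst instr_vars_subst all_map.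
case/and3P=> -> -> h /=; apply: sub_all h => y /=; rewrite /ren.
by case: eqP.
Qed.

Lemma ok_instr_sub D X X' i : X `<=` X' -> ok_instr D X i -> ok_instr D X' i.
Proof.
move=> /fsubsetP sub /and3P[h1 h2 h3]; apply/and3P; split=> //.
by apply: sub_all h3 => y /sub.
Qed.

(* The shape of run-time code: source code, followed by [Return] in a spawned task. *)
Fixpoint ok_code D X r : bool :=
  match r with
  | [::] | [:: Return] => true
  | i :: r' => ok_instr D X i && ok_code D X r'
  end.

Lemma ok_code_cons D X i r :
  ok_code D X (i :: r) =
  (if i is Return then nilp r else ok_instr D X i && ok_code D X r).
Proof. by case: i => [|y e|e b|e b|m e y||y|] //=; case: r. Qed.

Lemma ok_code_cat D X b r : all (ok_instr D X) b -> ok_code D X r -> ok_code D X (b ++ r).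
Proof.
move=> hb hr; elim: b hb => //= i b IH /andP[hi /IH hb].
by move: hi; rewrite -/(ok_code D X (i :: (b ++ r))) ok_code_cons hb andbT; case: i.
Qed.

Lemma ok_code_sub D X X' r : X `<=` X' -> ok_code D X r -> ok_code D X' r.
Proof.
move=> sub; elim: r => // i r IH; rewrite !ok_code_cons.
by case: i => [|? ?|? ?|? ?|? ? ?||?|] // /andP[/(ok_instr_sub sub)-> /IH].
Qed.

Definition has_return r := has (fun i => if i is Return then true else false) r.

Lemma ok_has_return D X b : all (ok_instr D X) b -> has_return b = false.
Proof. by elim: b => //= i b IH /andP[hi /IH->]; case: i hi. Qed.

Lemma ok_block D X e b : ok_instr D X (If e b) -> all (ok_instr D X) b.
Proof.
case/and3P=> /= /andP[_ h1] h2; rewrite all_cat => /andP[_ h3].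
elim: b h1 h2 h3 => //= i b IH /andP[i1 /IH IH1] /andP[i2 /IH1 IH2].
by rewrite all_cat => /andP[i3 /IH2 ->]; rewrite /ok_instr i1 i2 i3.
Qed.

(** A source instruction leaves only source instructions in front of [r], so the shape is kept and a
    final [Return] stays in [r]. Once [Return] itself has run nothing remains, hence the side
    condition. *)
Lemma ok_successor D X i r (b : @stmt L) : ok_code D X (i :: r) ->
    match i with
    | If _ b' => b = b' \/ b = [::]
    | While e b' => b = b' ++ [:: While e b'] \/ b = [::]
    | _ => b = [::]
    end ->
  ok_code D X (b ++ r) /\ (b ++ r <> [::] -> has_return (b ++ r) = has_return (i :: r)).
Proof.
rewrite ok_code_cons => hr hb.
have [hi|hi] : (i = Return /\ r = [::]) \/ (ok_instr D X i && ok_code D X r).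
  case: i hr {hb} => [|? ?|? ?|? ?|? ? ?||?|] hr; try by right.
  by left; case: r hr.
  by case: hi hb => -> -> ->.
have {hr hi} /andP[hi hr] := hi.
have hb' : all (ok_instr D X) b.
  case: i hi hb => [|? ?|e c|e c|? ? ?||?|] hi; try by move=> ->.
    by case=> ->; rewrite ?(ok_block hi).
  have hc : all (ok_instr D X) c by exact: (@ok_block D X e c hi).
  by case=> -> //; rewrite all_cat hc /= hi.
split=> [|_]; first exact: ok_code_cat.
rewrite /has_return has_cat -/(has_return b) (ok_has_return hb') /=.
by case: i hi {hb}.
Qed.

End Code.

(** * Invariants and transitions *)

Section Invariant.
Context {L : exprLang} (p : @program L).
Hypothesis p_wf : wf_program p.
Implicit Types (f g : tid L) (r : @stmt L) (k : @cont L) (C : @cconfig L).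

Notation D := (domf (procs p)).

Definition kseq f r : seq (@cont L) := if r is [::] then [::] else [:: Cont f r].

Lemma kontE f r : kont f r = seq_mset (kseq f r).
Proof. by case: r => [|i r]; rewrite /= ?seq_mset1 //; apply/msetP=> k; rewrite mset_seqE mset0E. Qed.

(* Distinct tasks have distinct keys: [Return] marks spawned tasks, so the main
   block is told apart even from a spawned task with the same identifier. *)
Definition key k : tid L * bool := (owner k, has_return (code k)).

(** Declared callees make [S2] applicable to markers; bound variables give every [Await] a value to
    test; distinct keys make the source of a continuation unique; the reaction events show that code
    with a [Return] belongs to a task already started. *)
Definition cinv C : Prop :=
  [/\ wf C.1,
      forall v m f, CallEv v m f \in core C.1 -> m \in D,
      exists t s, [/\ C.1 = rcons t (St s), prog_vars p `<=` domf s
        & forall k, k \in C.2 -> ok_code D (domf s) (code k)]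
    & exists l, [/\ C.2 = seq_mset l, uniq (map key l)
        & forall k, k \in l -> has_return (code k) ->
            exists v m, CallREv v m (owner k) \in core C.1]].

Lemma stmt_vars_ok X r : wf_stmt D r -> {subset stmt_vars r <= X} ->
  all (ok_instr D X) r.
Proof.
case/andP=> /andP[_ /allP h1] /allP h2 h3; apply/allP=> i ir.
apply/and3P; split; [exact: h1 | exact: h2 | apply/allP=> x xi].
by apply: h3; apply/flatten_mapP; exists i.
Qed.

Lemma main_ok : all (ok_instr D (prog_vars p)) (main_block p).
Proof.
case: p_wf => h _; apply: stmt_vars_ok h _ => x xm.
by rewrite in_fset /= mem_cat xm.
Qed.

Lemma proc_ok m d : (procs p).[? m] = Some d ->
  all (ok_instr D (prog_vars p)) (pbody d).
Proof.
move=> md; case: p_wf => _ /(_ _ _ md) h; apply: stmt_vars_ok h _ => x xm.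
rewrite in_fset /= mem_cat; apply/orP; right.
case: fndP md => // mp [ed]; apply/flatten_mapP; exists [` mp]; first by rewrite mem_enum.
by rewrite ed inE xm orbT.
Qed.

Lemma proc_subst_ok m d x X : (procs p).[? m] = Some d ->
  prog_vars p `<=` X -> x \in X ->
  ok_code D X (stmt_subst (pparam d) x (pbody d) ++ [:: Return]) /\
  has_return (stmt_subst (pparam d) x (pbody d) ++ [:: Return]).
Proof.
move=> md sub xX; split; last by rewrite /has_return has_cat orbT.
apply: ok_code_cat => //; rewrite all_map; apply: sub_all (proc_ok md) => i hi /=.
by apply: ok_instr_subst => //; apply: ok_instr_sub hi.
Qed.

Lemma cinv_init finit : cinv (cinit p finit).
Proof.
split=> /=; first exact: (WfState _ (WfNil)).
- by [].
- exists [::], (sigma_eps p); split=> // k.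
  rewrite kontE mem_seq_mset /kseq; case: (main_block p) main_ok => // i r h.
  by rewrite inE => /eqP->; have := ok_code_cat (r := [::]) h isT; rewrite cats0.
- exists (kseq finit (main_block p)); rewrite kontE; split=> //.
    by rewrite /kseq; case: (main_block p).
  move=> k; rewrite /kseq; case: (main_block p) main_ok => // i r h.
  by rewrite inE => /eqP->; rewrite (ok_has_return h).
Qed.

Lemma stmt_core_events f r s w r' : local_stmt f r s w r' -> core w = events w.
Proof.
case/local_stmt_inv=> i [r0 [i' [_ _ _ _ h]]].
suff : ~~ has is_done (events w) by rewrite /core -all_predC => /all_filterP.
case: i h => [|? ?|? ?|? ?|? ? ?||?|] h; rewrite ?h //.
- by case: h => ? [? ->].
- by case: h => ? [-> _].
- by case: h => ? ->.
Qed.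

Lemma proc_core_events f m d s w r : local_proc f m d s w r -> core w = events w.
Proof. by case/local_proc_inv=> v [x [_ _ ew]]; rewrite /core ew. Qed.

(** Only [Spawn] produces a call, and no statement produces a call reaction: those come from
    starting procedures alone. *)
Lemma stmt_calls f i r s w r' : local_stmt f (i :: r) s w r' ->
  (exists ev, [/\ events w = [:: ev] \/ events w = [::],
     forall v m g, ev <> CallEv v m g & forall v m g, ev <> CallREv v m g]) \/
  exists v m g, events w = [:: CallEv v m g] /\ exists e x, i = Spawn m e x.
Proof.
case/local_stmt_inv=> j [r0 [i' [[<- _] _ _ _ {j}]]].
(* [DoneEv] is a dummy witness for instructions without events. *)
case: i => [|? ?|? ?|? ?|m e x||?|] h; try by left; exists DoneEv; split=> //; right.
- by right; case: h => v [g ew]; exists v, m, g; split=> //; exists e, x.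
- by left; case: h => g [ew _]; exists (CompREv g); split=> //; left.
- by left; case: h => g ew; exists (CompEv g); split=> //; left.
Qed.

(** A statement step replaces one continuation by one with the same key or by none; a procedure step
    adds a continuation whose key is new, because its identifier has had no reaction before. *)
Lemma cinv_step C C' : cinv C -> cstep p C C' -> cinv C'.
Proof.
case=> wfC callD [t [s [es subs okC]]] [l [el ul rl]] st.
case: st es okC el rl callD wfC
  => [sh sh' Q f r r' sQ|sh sh' Q f m d r' sQ md]
  /realisesE => [/(_ (@stmt_starts_here _ _ _))|/(_ (@proc_starts_here _ _ _ _))]
  [t1 [s1 [w [/= -> esh' wf' loc]]]] /rcons_inj[et es1] okC el rl callD wfC; subst t1 s1.
- have cw := stmt_core_events loc.
  have [i [r0 [i' [er er' [w1 [s' [ew ss']]] hi' _]]]] := local_stmt_inv loc; subst r.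
  have okr : ok_code D (domf s) (i :: r0).
    by apply: (okC (Cont f (i :: r0))); rewrite in_msetD in_mset1 eqxx orbT.
  have [okr' hr'] := ok_successor okr hi'; rewrite -er' in okr' hr'.
  split=> //=.
  + move=> v m g; rewrite esh' core_cat mem_cat => /orP[/callD //|].
    rewrite cw; case: (stmt_calls loc) => [[ev [he n1 _]]|[v' [m' [g' [-> [e [x ei]]]]]]].
      by case: he => ->; rewrite ?inE // => /eqP e; case: (n1 v m g).
    rewrite inE => /eqP[_ -> _]; move: okr; rewrite ei ok_code_cons => /andP[/and3P[_ h _] _].
    exact: h.
  + exists (t ++ w1), s'; split.
    * by rewrite esh' -cats1 -catA cat1s ew rcons_cat.
    * exact: fsubset_trans subs ss'.
    move=> k; rewrite in_msetD => /orP[kQ|].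
      by apply: ok_code_sub ss' _; apply: okC; rewrite in_msetD kQ.
    rewrite kontE mem_seq_mset; case: r' {er' hr' loc} okr' => // j r' okr'.
    by rewrite inE => /eqP->; apply: ok_code_sub okr'.
  + have [l' eQ pl] := seq_mset_addr (esym el); subst Q.
    exists (l' ++ kseq f r'); rewrite seq_mset_cat kontE; split=> //.
      move: ul; rewrite (perm_uniq (perm_map key pl)) /= => /andP[hn ul].
      rewrite map_cat /kseq.
      case: r' {er' loc okr'} hr' => [|j r'] hr'; first by rewrite cats0.
      have ek : key (Cont f (j :: r')) = key (Cont f (i :: r0)) by congr pair; apply: hr'.
      by rewrite /= cats1 rcons_uniq ul andbT ek.
    move=> k; rewrite mem_cat esh' core_cat => /orP[kl'|].
      move=> hk; have [|v [m h]] := rl k _ hk; first by rewrite (perm_mem pl) inE kl' orbT.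
      by exists v, m; rewrite mem_cat h.
    case: r' {er' loc okr'} hr' => // j r' hr'; rewrite inE => /eqP-> hk.
    have {}hk : has_return (i :: r0) by rewrite -hr'.
    have [|v [m h]] := rl (Cont f (i :: r0)) _ hk.
      by rewrite (perm_mem pl) inE eqxx.
    by exists v, m; rewrite mem_cat h.
- have [v [x' [er' [w1 [s' [ew ss' x's']]] evw]]] := local_proc_inv loc.
  have cw := proc_core_events loc; rewrite evw in cw.
  have subs' := fsubset_trans subs ss'.
  have [okr' retr'] := proc_subst_ok md subs' x's'; rewrite -er' in okr' retr'.
  have csh' : core sh' = rcons (core (rcons t (St s))) (CallREv v m f).
    by rewrite esh' core_cat cw cats1.
  (* An earlier reaction for [f] would answer the same unique call, hence coincide with the present
     one, which [wf] forbids. *)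
  have fresh v' m' : CallREv v' m' f \notin core (rcons t (St s)).
    have [h1 h2] : wf (rcons (rcons t (St s)) (Ev (CallREv v m f))) /\ True.
      by split=> //; apply: wf_eq_core wf'; rewrite csh' core_rcons_Ev.
    have /wf_rcons[_ [hc hnc]] := h1; apply/negP=> h.
    have [e1 e2] := call_unique wfC hc (callR_call wfC h).
    by move: hnc; rewrite e1 e2 h.
  split=> //=.
  + move=> v' m' g; rewrite csh' mem_rcons inE => /orP[/eqP //|]; exact: callD.
  + exists (t ++ w1), s'; split=> //.
      by rewrite esh' -cats1 -catA cat1s ew rcons_cat.
    move=> k; rewrite in_msetD => /orP[kQ|].
      by apply: ok_code_sub ss' _; apply: okC.
    by rewrite kontE mem_seq_mset; case: (r') okr' => // j r1 okr1; rewrite inE => /eqP->.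
  + exists (l ++ kseq f r'); rewrite seq_mset_cat kontE el; split=> //.
      rewrite map_cat /kseq; case: (r') retr' => // j r1 retr1.
      rewrite /= cats1 rcons_uniq ul andbT; apply/mapP=> -[k kl [eo er]].
      have [|v0 [m0]] := rl k kl; first by rewrite -er.
      by rewrite -eo (negbTE (fresh _ _)).
    move=> k; rewrite mem_cat csh' => /orP[kl|].
      by move=> hk; have [v0 [m0 h]] := rl k kl hk; exists v0, m0; rewrite mem_rcons inE h orbT.
    rewrite /kseq; case: (r') => // j r1; rewrite inE => /eqP-> _.
    by exists v, m; rewrite mem_rcons inE eqxx.
Qed.

(** * The scheduler invariant and the simulation of scheduler steps *)

Implicit Types (sh : @ctrace L) (q : @queue L) (c : @sconfig L).

Definition tasks q : seq (pname * tid L) :=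
  pmap (fun a => if a is QTask m f then Some (m, f) else None) q.

(** The call just made, whose marker [S1] has still to enqueue. *)
Definition pending sh : seq (pname * tid L) :=
  if last_event sh is Some (CallEv _ m f) then [:: (m, f)] else [::].

Definition unmatched sh m f : Prop :=
  exists v, CallEv v m f \in core sh /\ CallREv v m f \notin core sh.

(** The queued markers and the pending call are exactly the calls without reaction, so every task
    that may start has its marker waiting. The trace and its image end in the same state, so local
    evaluation agrees on them. *)
Definition sinv c : Prop :=
  [/\ cinv (M_config c),
      exists t u s, c.1 = rcons t (St s) /\ M_trace c.1 = rcons u (St s),
      forall k, QCont k \in c.2.2 -> suspended (code k),
      uniq (map snd (pending c.1 ++ tasks c.2.2))
    & forall m f, (m, f) \in pending c.1 ++ tasks c.2.2 <-> unmatched c.1 m f].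

(* Recognises (S2), (S3) and (S5); the other transition which may end with an
   active task is (S1), and it lengthens the queue. *)
Definition real c c' : bool :=
  (if c'.2.1 is Active _ then true else false) && (size c'.2.2 <= size c.2.2).

Lemma pending_nil sh : no_pending_call sh -> pending sh = [::].
Proof. by rewrite /pending /no_pending_call; case: (last_event sh) => [[v m f /(_ v m f)[]||||]|]. Qed.

Lemma M_queue_cons k q : M_queue (QCont k :: q) = (M_queue q `+` [mset k])%mset.
Proof. by rewrite /M_queue /= -cat1s seq_mset_cat seq_mset1 msetDC. Qed.

Lemma M_queue_rcons k q : M_queue (rcons q (QCont k)) = (M_queue q `+` [mset k])%mset.
Proof. by rewrite /M_queue -cats1 pmap_cat seq_mset_cat seq_mset1. Qed.

Lemma M_queue_rcons_task m f q : M_queue (rcons q (QTask m f)) = M_queue q.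
Proof. by rewrite /M_queue -cats1 pmap_cat cats0. Qed.

Lemma mem_M_queue k q : (k \in M_queue q) = (QCont k \in q).
Proof.
rewrite mem_seq_mset mem_pmap; elim: q => //= a q IH; rewrite !inE IH; congr orb.
case: a => [k'|m f]; last by rewrite [RHS](introF eqP).
by apply/eqP/eqP=> [[->]|[->]].
Qed.

Lemma mem_tasks m f q : ((m, f) \in tasks q) = (QTask m f \in q).
Proof.
rewrite mem_pmap; elim: q => //= a q IH; rewrite !inE IH; congr orb.
case: a => [k'|m' f']; first by rewrite [RHS](introF eqP).
by apply/eqP/eqP=> [[-> ->]|[-> ->]].
Qed.

Lemma queue_suspended q : (forall k, QCont k \in q -> suspended (code k)) ->
  all_suspended (M_queue q).
Proof. by move=> h k; rewrite mem_M_queue; apply: h. Qed.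

Lemma sinv_wf c : sinv c -> wf c.1.
Proof. by case=> -[h _ _ _] _ _ _ _; apply: wf_eq_core h; rewrite core_M_trace. Qed.

Lemma M_config_sinit finit : M_config (sinit p finit) = cinit p finit.
Proof.
rewrite /M_config /M_sched /=; congr pair; rewrite -[RHS](mset0D); congr msetD.
by apply/msetP=> k; rewrite mset_seqE mset0E.
Qed.

Lemma sinv_init finit : sinv (sinit p finit).
Proof.
split=> //.
- by rewrite M_config_sinit; apply: cinv_init.
- by exists [::], [::], (sigma_eps p).
- by move=> m f; split=> // -[v []].
Qed.

(** Both traces end in [s] and have the same [core], so local evaluation and well-formedness carry
    over; the suffix contains no [DoneEv] and is kept by [M_trace]. *)
Lemma realises_M (V : sstate -> {fset expr} -> strace -> stmt -> Prop) sh sh' r t u s :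
  starts_here V -> (forall w r', local V s w r' -> core w = events w) ->
  sh = rcons t (St s) -> M_trace sh = rcons u (St s) -> realises V sh sh' r ->
  exists w, [/\ sh' = sh ++ w, wf sh', local V s w r, M_trace sh' = M_trace sh ++ w
    & realises V (M_trace sh) (M_trace sh') r].
Proof.
move=> hV hw e1 e2 re; have [t1 [s1 [w [e3 e4 wf' loc]]]] := iffLR (realisesE _ _ _ hV) re.
have /rcons_inj[_ es] := etrans (esym e1) e3; subst s1.
have e5 : M_trace sh' = M_trace sh ++ w.
  by rewrite e4 e1 M_trace_cat (M_trace_id (hw _ _ loc)).
exists w; split=> //; apply: (iffRL (realisesE _ _ _ hV)); exists u, s, w; split=> //.
by apply: wf_eq_core wf'; rewrite core_M_trace.
Qed.

(** Converse direction: what the image can realise is also available to the trace with its [DoneEv]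
    events. *)
Lemma M_realises (V : sstate -> {fset expr} -> strace -> stmt -> Prop) sh sh' r t u s :
  starts_here V ->
  sh = rcons t (St s) -> M_trace sh = rcons u (St s) -> realises V (M_trace sh) sh' r ->
  exists w, [/\ local V s w r, wf (sh ++ w) & realises V sh (sh ++ w) r].
Proof.
move=> hV e1 e2 re; have [t1 [s1 [w [e3 e4 wf' loc]]]] := iffLR (realisesE _ _ _ hV) re.
have /rcons_inj[_ es] := etrans (esym e2) e3; subst s1.
have wfw : wf (sh ++ w).
  by apply: wf_eq_core wf'; rewrite e4 !core_cat core_M_trace.
by exists w; split=> //; apply: (iffRL (realisesE _ _ _ hV)); exists t, s, w.
Qed.

Lemma S1_trace sh sh' s : last_state sh = Some s ->
  chop sh [:: St s; Ev DoneEv; St s] sh' -> sh' = sh ++ [:: Ev DoneEv; St s].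
Proof.
move=> hs h; inversion h as [t s1 s2 t' hx e1 e2 e3]; subst.
by move: hs; rewrite last_state_rcons => -[->]; rewrite -cats1 -catA.
Qed.

Lemma sstep_sim c c' : sinv c -> sstep p c c' ->
  if real c c' then cstep p (M_config c) (M_config c') else M_config c = M_config c'.
Proof.
case=> _ [t [u [s [et eu]]]] sq _ _ st.
case: {c c'} st et eu sq => /=.
- move=> sh sh' s1 act q v m f le ls ch et eu _.
  rewrite /real /= size_rcons ltnn andbF.
  rewrite /M_config /= (S1_trace ls ch) et M_trace_cat cats0; congr pair.
  by rewrite /M_sched /= /push M_queue_rcons_task.
- move=> sh sh' q q' m f d r' _; case: q => // _ q [-> ->] md re et eu sq.
  rewrite /real /= leqnSn /M_config /M_sched /=.
  have [w [_ _ _ _ re']] :=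
    realises_M (@proc_starts_here _ _ _ _) (@proc_core_events _ _ _ _) et eu re.
  by apply: (C2 _ md re'); exact: queue_suspended sq.
- move=> sh sh' q q' f r r' _; case: q => // _ q [-> ->] re et eu sq.
  rewrite /real /= leqnSn /M_config /M_sched /= M_queue_cons.
  have [w [_ _ _ _ re']] :=
    realises_M (@stmt_starts_here _ _ _) (@stmt_core_events _ _ _) et eu re.
  by apply: (C1 _ _ re'); apply: queue_suspended => k kq; apply: sq; rewrite inE kq orbT.
- move=> sh s1 q q' q'' f x r _ _; case: q => // _ q [-> ->] _ [<-] et eu sq.
  by rewrite /real /= /M_config /M_sched /= /push M_queue_rcons M_queue_cons.
- move=> sh sh' q f r r' _ sr re et eu sq.
  have [w [_ _ loc _ re']] :=
    realises_M (@stmt_starts_here _ _ _) (@stmt_core_events _ _ _) et eu re.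
  rewrite /real /= leqnn /M_config /M_sched /=.
  (* Code that can be evaluated is nonempty, so [kont] does not delete the active continuation. *)
  have [i [r0 [i' [er _ _ _ _]]]] := local_stmt_inv loc; rewrite {1}er /=.
  by rewrite -er; apply: (C1 _ _ re'); apply: queue_suspended.
- by move=> sh q f _ et eu sq; rewrite /real /M_config /M_sched /= msetD0.
- move=> sh q f r _ sr et eu sq; rewrite /real /M_config /M_sched /= /push M_queue_rcons.
  by case: r sr.
Qed.

Lemma pmap_rcons_task q m f : tasks (rcons q (QTask m f)) = rcons (tasks q) (m, f).
Proof. by rewrite /tasks -cats1 pmap_cat cats1. Qed.

Lemma tasks_rcons_cont q k : tasks (rcons q (QCont k)) = tasks q.
Proof. by rewrite /tasks -cats1 pmap_cat cats0. Qed.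

Lemma unmatched_eq_core sh sh' m f : core sh = core sh' ->
  unmatched sh m f <-> unmatched sh' m f.
Proof. by rewrite /unmatched => ->. Qed.

Lemma last_event_nil sh w : events w = [::] -> last_event (sh ++ w) = last_event sh.
Proof. by rewrite last_event_cat /last_event -!/(events _) => ->. Qed.

Lemma last_event_1 sh w ev : events w = [:: ev] -> last_event (sh ++ w) = Some ev.
Proof. by rewrite last_event_cat /last_event -!/(events _) => ->. Qed.

(** Covers [S3] and [S5]. Steps other than a spawn leave the unmatched calls alone; a spawn adds one
    call, whose identifier is fresh by well-formedness, and this call becomes pending. *)
Lemma tasks_step sh w q f i r s r' : wf sh -> wf (sh ++ w) -> no_pending_call sh ->
  local_stmt f (i :: r) s w r' ->
  uniq (map snd (tasks q)) ->
  (forall m g, (m, g) \in tasks q <-> unmatched sh m g) ->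
  uniq (map snd (pending (sh ++ w) ++ tasks q)) /\
  (forall m g, (m, g) \in pending (sh ++ w) ++ tasks q <-> unmatched (sh ++ w) m g).
Proof.
move=> wf1 wf2 N loc uq hq; have cw := stmt_core_events loc.
case: (stmt_calls loc) => [[ev [he n1 n2]]|[v [m [g [ew _]]]]].
  have -> : pending (sh ++ w) = [::].
    apply: pending_nil => v m g; case: he => he.
      by rewrite (last_event_1 _ he) => -[]; apply: n1.
    by rewrite last_event_nil.
  split=> // m g; rewrite hq; split=> -[v [h1 h2]]; exists v; move: h1 h2.
    move=> h1 h2; rewrite core_cat !mem_cat h1 negb_or h2 /= cw; split=> //.
    by case: he => ->; rewrite ?inE //; apply/eqP=> e; apply: (n2 v m g).
  rewrite core_cat !mem_cat negb_or cw => h1 /andP[-> _]; split=> //.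
  case/orP: h1 => //; case: he => ->; rewrite ?inE // => /eqP e.
  by case: (n1 v m g).
have ec : core (sh ++ w) = rcons (core sh) (CallEv v m g) by rewrite core_cat cw ew cats1.
have -> : pending (sh ++ w) = [:: (m, g)] by rewrite /pending (last_event_1 _ ew).
have nc v' m' : CallEv v' m' g \notin core sh.
  have : wf (rcons sh (Ev (CallEv v m g))) by apply: wf_eq_core wf2; rewrite ec core_rcons_Ev.
  by case/wf_rcons=> _; apply.
split.
  rewrite /= uq andbT; apply/mapP=> -[[m' g'] /hq[v' [h _]] /= eg].
  by move: (nc v' m'); rewrite eg h.
move=> m' g'; rewrite inE; split.
  case/orP=> [/eqP[-> ->]|/hq[v' [h1 h2]]].
    exists v; rewrite ec !mem_rcons !inE eqxx; split=> //; rewrite negb_or.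
    apply/andP; split; first by apply/eqP.
    by apply/negP=> /(callR_call wf1); apply/negP.
  exists v'; rewrite ec !mem_rcons !inE h1 orbT negb_or h2 andbT; split=> //.
  by apply/eqP.
case=> v' []; rewrite ec !mem_rcons !inE negb_or => /orP[/eqP[_ -> ->] _|h1 /andP[_ h2]].
  by rewrite eqxx.
by apply/orP; right; apply/hq; exists v'.
Qed.

Lemma sinv_step c c' : sinv c -> sstep p c c' -> sinv c'.
Proof.
move=> I st; have wfc := sinv_wf I; have sim := sstep_sim I st.
have cI : cinv (M_config c').
  by case: ifP sim I => [_ h [cI _ _ _ _]|_ <- []] //; apply: cinv_step h.
case: I => _ [t [u [s [et eu]]]] sq uq hq {sim}.
case: st wfc et eu sq uq hq cI => /=.
- move=> sh sh' s1 act q v m f le ls ch wfs et eu sq uq hq cI.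
  have esh' := S1_trace ls ch.
  have p0 : pending sh = [:: (m, f)] by rewrite /pending le.
  have p1 : pending sh' = [::].
    by rewrite /pending esh' (@last_event_1 _ _ DoneEv).
  (* [S1] only moves the pending call to the rear of the queue. *)
  have pe : perm_eq (pending sh ++ tasks q) (pending sh' ++ tasks (push q (QTask m f))).
    by rewrite p0 p1 pmap_rcons_task perm_sym perm_rcons.
  split=> //=.
  + have es1 : s1 = s by move: ls; rewrite et last_state_rcons => -[].
    exists (rcons (rcons t (St s)) (Ev DoneEv)), u, s; rewrite esh'; split.
      by rewrite et es1 -!cats1 -!catA.
    by rewrite et M_trace_cat cats0 -et.
  + move=> k; rewrite mem_rcons inE => /orP[/eqP //|]; exact: sq.
  + by rewrite -(perm_uniq (perm_map snd pe)).
  + move=> m' f'; rewrite -(perm_mem pe) hq; apply: unmatched_eq_core.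
    by rewrite esh' core_cat cats0.
- move=> sh sh' q q' m f d r' N; case: q => // _ q [-> ->] md re wfs et eu sq uq hq cI.
  have [w [esh' wf' loc eM _]] :=
    realises_M (@proc_starts_here _ _ _ _) (@proc_core_events _ _ _ _) et eu re.
  have [v [x' [_ [w1 [s' [ew _ _]]] evw]]] := local_proc_inv loc.
  rewrite (pending_nil N) /= in uq hq.
  have p1 : pending sh' = [::] by rewrite /pending esh' (last_event_1 _ evw).
  have csh' : core sh' = rcons (core sh) (CallREv v m f).
    by rewrite esh' core_cat (proc_core_events loc) evw cats1.
  have hin : CallEv v m f \in core sh.
    have : wf (rcons sh (Ev (CallREv v m f))).
      by apply: wf_eq_core wf'; rewrite csh' core_rcons_Ev.
    by case/wf_rcons=> _ [].
  split=> //=.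
  + exists (t ++ w1), (u ++ w1), s'; rewrite eM eu esh' et -!cats1 -!catA !cat1s ew.
    by rewrite -!cats1.
  + by move=> k kq; apply: sq; rewrite inE kq orbT.
  + by rewrite p1; case/andP: uq.
  + move=> m' f'; rewrite p1 /=; case/andP: uq => nf _; split.
      move=> h; have [|v' [h1 h2]] := proj1 (hq m' f'); first by rewrite inE h orbT.
      exists v'; rewrite csh' !mem_rcons !inE h1 orbT negb_or h2 andbT; split=> //.
      by apply/eqP=> -[_ _ ef]; move/mapP: nf; case; exists (m', f').
    case=> v' []; rewrite csh' !mem_rcons !inE negb_or => /orP[/eqP //|h1] /andP[n1 h2].
    have : (m', f') \in (m, f) :: tasks q' by apply/hq; exists v'.
    rewrite inE => /orP[/eqP[em ef]|//]; subst m' f'.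
    (* Equal identifiers force equal arguments, but then this call has just received its
       reaction. *)
    by have [ev _] := call_unique wfs hin h1; rewrite ev eqxx in n1.
- move=> sh sh' q q' f r r' N; case: q => // _ q [-> ->] re wfs et eu sq uq hq cI.
  have [w [esh' wf' loc eM _]] :=
    realises_M (@stmt_starts_here _ _ _) (@stmt_core_events _ _ _) et eu re.
  have [i [r0 [i' [er _ [w1 [s' [ew _]]] _ _]]]] := local_stmt_inv loc.
  rewrite (pending_nil N) /= in uq hq; rewrite er in loc; rewrite esh' in wf'.
  have [uq' hq'] := tasks_step wfs wf' N loc uq hq; rewrite -esh' in uq' hq'.
  split=> //=.
  + exists (t ++ w1), (u ++ w1), s'; rewrite eM eu esh' et -!cats1 -!catA !cat1s ew.
    by rewrite -!cats1.
  + by move=> k kq; apply: sq; rewrite inE kq orbT.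
- move=> sh s1 q q' q'' f x r N _; case: q => // _ q [-> ->] _ [<-] wfs et eu sq uq hq cI.
  split=> //=; rewrite /push ?tasks_rcons_cont //.
  + by exists t, u, s.
  + by move=> k kq; apply: sq; rewrite mem_rcons in kq.
- move=> sh sh' q f r r' N sr re wfs et eu sq uq hq cI.
  have [w [esh' wf' loc eM _]] :=
    realises_M (@stmt_starts_here _ _ _) (@stmt_core_events _ _ _) et eu re.
  have [i [r0 [i' [er _ [w1 [s' [ew _]]] _ _]]]] := local_stmt_inv loc.
  rewrite (pending_nil N) /= in uq hq; rewrite er in loc; rewrite esh' in wf'.
  have [uq' hq'] := tasks_step wfs wf' N loc uq hq; rewrite -esh' in uq' hq'.
  split=> //=.
  exists (t ++ w1), (u ++ w1), s'; rewrite eM eu esh' et -!cats1 -!catA !cat1s ew.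
  by rewrite -!cats1.
- by move=> sh q f N wfs et eu sq uq hq cI; split=> //=; exists t, u, s.
- move=> sh q f r N sr wfs et eu sq uq hq cI.
  split=> //=; rewrite /push ?tasks_rcons_cont //.
  + by exists t, u, s.
  + by move=> k; rewrite mem_rcons inE => /orP[/eqP[->]|/sq].
Qed.

(** * Enabled continuations and the popping of queue elements *)

Definition ready sh (i : @instr L) : Prop :=
  forall x, i = Await x -> exists2 s, last_state sh = Some s & completed sh s x.

(** The common part [Q] cancels in the difference, so at most the continuation produced by the step
    is new. *)
Lemma in_new_stmt (Q R : {mset @cont L}) C C' k : C.2 = (Q `+` R)%mset ->
  forall f r, C'.2 = (Q `+` kont f r)%mset -> k \in new_stmt C C' ->
  k = Cont f r /\ r <> [::].
Proof.
move=> eC f r eC'; rewrite /new_stmt eC eC' in_msetB !msetE2.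
have [|kr] := boolP (k \in kont f r).
  by rewrite kontE mem_seq_mset; case: r {eC'} => // i r; rewrite inE => /eqP.
by rewrite (mset_eq0P kr); lia.
Qed.

(** [wf] admits a [CompREv] only after the matching [CompEv]; as [x] is bound, the identifier in
    question is its value. *)
Lemma await_completed f x r t s w r' : let sh := rcons t (St s) in
  local_stmt f (Await x :: r) s w r' -> x \in domf s -> wf (sh ++ w) ->
  completed sh s x.
Proof.
move=> sh loc xs wfw; have cw := stmt_core_events loc.
have [i [r0 [i' [[ei _] _ _ _]]]] := local_stmt_inv loc.
rewrite -ei => -[g [ew /(_ xs) sx]]; exists g => //.
have : wf (rcons sh (Ev (CompREv g))).
  by apply: wf_eq_core wfw; rewrite core_cat cw ew core_rcons_Ev cats1.
by case/wf_rcons=> _ /=; rewrite mem_core.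
Qed.

Lemma stmt_ready f (i : @instr L) r t s w r' : let sh := rcons t (St s) in
  ok_code D (domf s) (i :: r) -> local_stmt f (i :: r) s w r' -> wf (sh ++ w) ->
  ready sh i.
Proof.
move=> sh okr loc wfw x ei; subst i; exists s; first exact: last_state_rcons.
apply: await_completed loc _ wfw.
by move: okr; rewrite ok_code_cons => /andP[/and3P[_ _ /=]]; rewrite andbT.
Qed.

Lemma proc_unmatched f m d t s w r' : let sh := rcons t (St s) in
  local_proc f m d s w r' -> wf (sh ++ w) -> unmatched sh m f /\ has_return r'.
Proof.
move=> sh loc wfw; have [v [x [-> _ ew]]] := local_proc_inv loc.
have cw := proc_core_events loc.
split; last by rewrite /has_return has_cat orbT.
have : wf (rcons sh (Ev (CallREv v m f))).
  by apply: wf_eq_core wfw; rewrite core_cat cw ew core_rcons_Ev cats1.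
by case/wf_rcons=> _ [h1 h2]; exists v.
Qed.

Lemma suspended_local f (i : @instr L) r s w r' : suspended (i :: r) ->
  local_stmt f (i :: r) s w r' -> r' = r.
Proof.
move=> si /local_stmt_inv[j [r0 [i' [[<- <-] -> _ hi' _]]]].
by case: i si hi' => // *; subst.
Qed.

Lemma sinv_ok_code c t s k : sinv c -> c.1 = rcons t (St s) ->
  k \in M_sched c.2 -> ok_code D (domf s) (code k).
Proof.
case=> -[_ _ [t1 [s1 [es1 _ h]]] _] [t2 [u [s2 [et eu]]]] _ _ _ et' kc.
have /rcons_inj[_ e1] := etrans (esym et) et'.
have /rcons_inj[_ e2] := etrans (esym eu) es1.
by move: e1 e2 => <- ->; apply: h.
Qed.

(** Without an active task a transition either resumes a queued continuation, dropping its first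
    instruction, or reacts to an unmatched call, whose code ends with [Return]. *)
Lemma idle_cstep sh q C' : sinv (sh, (Idle, q)) ->
  cstep p (M_config (sh, (Idle, q))) C' ->
  (exists f i r, [/\ QCont (Cont f (i :: r)) \in q, ready sh i
    & forall k, k \in new_stmt (M_config (sh, (Idle, q))) C' -> k = Cont f r /\ r <> [::]])
  \/
  (exists m f, unmatched sh m f /\
    forall k, k \in new_stmt (M_config (sh, (Idle, q))) C' ->
      owner k = f /\ has_return (code k)).
Proof.
move=> I; have [_ [t [u [s [et eu]]]] sq _ _] := I; rewrite /= in et eu sq.
move eC : (M_config (sh, (Idle, q))) => C st.
case: st eC => [sh1 sh' Q f r r' _|sh1 sh' Q f m d r' _ md] re [e1 eQ].
- rewrite -e1 in re; have [w [loc wfw _]] := M_realises (@stmt_starts_here _ _ _) et eu re.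
  have [i [r0 [_ [er _ _ _ _]]]] := local_stmt_inv loc; subst r.
  have rq : QCont (Cont f (i :: r0)) \in q.
    by rewrite -mem_M_queue -[M_queue q]/(M_sched (Idle, q)) eQ in_msetD in_mset1 eqxx orbT.
  left; exists f, i, r0; split=> //.
    rewrite et in wfw *; apply: stmt_ready loc wfw.
    apply: (sinv_ok_code (k := Cont f (i :: r0)) I et); by rewrite mem_M_queue.
  by move=> k; rewrite -(suspended_local (sq _ rq) loc); apply: in_new_stmt.
- rewrite -e1 in re; have [w [loc wfw _]] := M_realises (@proc_starts_here _ _ _ _) et eu re.
  rewrite et in wfw *; have [um hr] := proc_unmatched loc wfw.
  right; exists m, f; split=> // k kn.
  have e0 : (sh1, Q).2 = (Q `+` mset0)%mset by rewrite msetD0.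
  by have [-> _] := in_new_stmt e0 (erefl (sh', Q `+` kont f r')%mset.2) kn.
Qed.

Lemma pop_inv sh a q c' : no_pending_call sh -> sstep p (sh, (Idle, a :: q)) c' ->
  match a with
  | QTask m f => exists d sh' r', [/\ (procs p).[? m] = Some d,
      realises (fun s => val_proc f s m d) sh sh' r' & c' = (sh', (Active (Cont f r'), q))]
  | QCont (Cont f r) =>
      (exists sh' r', realises (fun s => val_stmt f s r) sh sh' r' /\
         c' = (sh', (Active (Cont f r'), q))) \/
      (exists x r0 s, [/\ r = Await x :: r0, last_state sh = Some s, ~ completed sh s x
         & c' = (sh, (Idle, rcons q a))])
  end.
Proof.
move=> N; move ec : (sh, (Idle, a :: q)) => c st.
case: st ec => //=.
- by move=> sh1 sh' s1 act q1 v m g le _ _ [e1 _ _]; move: le; rewrite -e1 => /N.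
- move=> sh1 sh' q1 q' m g d r' _ ep md re [e1 eq]; move: ep re; rewrite -eq -e1.
  by case=> <- -> re; exists d, sh', r'.
- move=> sh1 sh' q1 q' g r r' _ ep re [e1 eq]; move: ep re; rewrite -eq -e1.
  by case=> <- -> re; left; exists sh', r'.
- move=> sh1 s q1 q' q'' g x r _ ls ep nc er [e1 eq]; move: ep er ls nc; rewrite -eq -e1.
  by case=> _ -> [<-] ls nc; right; exists x, r, s.
Qed.

(** Readiness excludes [S4], so the front element is resumed by [S3]. *)
Lemma pop_cont sh f (i : @instr L) r q c' :
  let c := (sh, (Idle, QCont (Cont f (i :: r)) :: q)) in
  sinv c -> no_pending_call sh -> ready sh i -> sstep p c c' ->
  real c c' /\ (r <> [::] -> Cont f r \in new_stmt (M_config c) (M_config c')).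
Proof.
move=> c I N rdy st; have [_ [t [u [s [et eu]]]] sq _ _] := I; rewrite /= in et eu sq.
case: (pop_inv N st) => [[sh' [r' [re ->]]]|[x [r0 [s1 [[ei _] ls nc _]]]]]; last first.
  by have [s2] := rdy x ei; rewrite ls => -[<-].
have [w [_ _ loc _ _]] :=
  realises_M (@stmt_starts_here _ _ _) (@stmt_core_events _ _ _) et eu re.
rewrite (suspended_local (sq _ (mem_head _ _)) loc).
split=> [|r0]; first by rewrite /real /= leqnSn.
rewrite /new_stmt /c /M_config /M_sched /= M_queue_cons in_msetB !msetE2.
(* The popped continuation has longer code than [Cont f r], so it cancels nothing in the multiset
   difference. *)
rewrite msetnE kontE mset_seqE; case: eqP => [[]|_].
  by move/(congr1 size) => /=; lia.
by case: (r) r0 => // j r1 _ /=; rewrite eqxx; lia.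
Qed.

Definition reacted sh f : Prop := exists v m, CallREv v m f \in core sh.

(** An identifier has only one call, and the reaction has answered it. *)
Lemma reacted_not_unmatched sh m f : wf sh -> reacted sh f -> ~ unmatched sh m f.
Proof.
move=> wfs [v [m1 h]] [v1 [h1 h2]].
have [ev em] := call_unique wfs (callR_call wfs h) h1.
by move: h2; rewrite -ev -em h.
Qed.

Lemma sstep_core c c' : sinv c -> sstep p c c' -> {subset core c.1 <= core c'.1}.
Proof.
case=> _ [t [u [s [et eu]]]] _ _ _ st; case: st et eu => //=.
- by move=> sh sh' s1 act q v m f _ ls ch _ _ ev; rewrite (S1_trace ls ch) core_cat mem_cat => ->.
- move=> sh sh' q q' m f d r' _ _ _ re et eu ev.
  have [w [-> _ _ _ _]] :=
    realises_M (@proc_starts_here _ _ _ _) (@proc_core_events _ _ _ _) et eu re.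
  by rewrite core_cat mem_cat => ->.
- move=> sh sh' q q' f r r' _ _ re et eu ev.
  have [w [-> _ _ _ _]] :=
    realises_M (@stmt_starts_here _ _ _) (@stmt_core_events _ _ _) et eu re.
  by rewrite core_cat mem_cat => ->.
- by move=> * ev.
- move=> sh sh' q f r r' _ _ re et eu ev.
  have [w [-> _ _ _ _]] :=
    realises_M (@stmt_starts_here _ _ _) (@stmt_core_events _ _ _) et eu re.
  by rewrite core_cat mem_cat => ->.
- by move=> * ev.
- by move=> * ev.
Qed.

Lemma pop_task sh m f q c' : let c := (sh, (Idle, QTask m f :: q)) in
  sinv c -> no_pending_call sh -> sstep p c c' -> real c c' /\ reacted c'.1 f.
Proof.
move=> c I N st; have [_ [t [u [s [et eu]]]] _ _ _] := I; rewrite /= in et eu.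
have [d [sh' [r' [md re ->]]]] := pop_inv N st.
have [w [-> _ loc _ _]] :=
  realises_M (@proc_starts_here _ _ _ _) (@proc_core_events _ _ _ _) et eu re.
have [v [x [_ _ ew]]] := local_proc_inv loc.
split; first by rewrite /real /= leqnSn.
by exists v, m; rewrite core_cat (proc_core_events loc) ew mem_cat mem_head orbT.
Qed.

(* Otherwise [Cont f r] could be enabled forever, now through one [await], now
   through another, without any of them being ready when it is polled. *)
Lemma source_unique sh q f (i j : @instr L) r : sinv (sh, (Idle, q)) -> r <> [::] ->
  QCont (Cont f (i :: r)) \in q -> QCont (Cont f (j :: r)) \in q -> i = j.
Proof.
case=> -[_ _ _ [l [el ul _]]] _ sq _ _ r0 iq jq.
have inl k : QCont k \in q -> k \in l.
  by rewrite -mem_M_queue -(mem_seq_mset k l) -el.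
have hr i0 : suspended (i0 :: r) -> has_return (i0 :: r) = has_return r by case: i0.
have ek : key (Cont f (i :: r)) = key (Cont f (j :: r)).
  by congr pair; rewrite (hr _ (sq _ iq)) (hr _ (sq _ jq)).
pose k0 := Cont f r.
have := nth_index k0 (inl _ iq); have := nth_index k0 (inl _ jq).
have li := inl _ iq; have lj := inl _ jq.
rewrite -!index_mem in li lj.
set a := index _ _ in li *; set b := index _ _ in lj *; move=> nb na.
have : nth (key k0) (map key l) a = nth (key k0) (map key l) b.
  by rewrite !(nth_map k0) // na nb.
move/eqP; rewrite nth_uniq ?size_map // => /eqP eab.
by move: na; rewrite eab nb => -[].
Qed.

Lemma return_reacted sh q f r : sinv (sh, (Idle, q)) -> QCont (Cont f r) \in q ->
  has_return r -> reacted sh f.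
Proof.
case=> -[_ _ _ [l [el _ rl]]] _ _ _ _ iq hr.
have := rl (Cont f r); rewrite -(mem_seq_mset _ l) -el /= core_M_trace; apply=> //.
by rewrite /M_sched mem_M_queue.
Qed.

(** The active continuation is not suspended, hence not in the [Q] of either rule; the step must be
    a [C1] step running it. *)
Lemma active_cstep sh f r q C' : let c := (sh, (Active (Cont f r), q)) in
  sinv c -> ~~ suspended r -> r <> [::] -> cstep p (M_config c) C' ->
  exists sh' r', realises (fun s => val_stmt f s r) sh sh' r'.
Proof.
move=> c I nsr r0; have [_ [t [u [s [et eu]]]] _ _ _] := I; rewrite /= in et eu.
have eM : M_sched (Active (Cont f r), q) = (M_queue q `+` [mset Cont f r])%mset.
  by rewrite /M_sched /=; case: (r) r0.
have notin Q : all_suspended Q -> Cont f r \notin Q.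
  by move=> h; apply/negP=> /h /=; apply/negP.
move eC : (M_config c) => C st.
case: st eC => [sh1 sh' Q g r1 r' sQ|sh1 sh' Q g m d r' sQ _] re [e1 eQ].
  have : Cont f r \in (Q `+` [mset Cont g r1])%mset.
    by rewrite -eQ eM in_msetD in_mset1 eqxx orbT.
  rewrite in_msetD (negbTE (notin _ sQ)) in_mset1 => /eqP[eg er].
  move: re; rewrite -e1 -eg -er => re.
  by have [w [_ _ h]] := M_realises (@stmt_starts_here _ _ _) et eu re; exists (sh ++ w), r'.
have : Cont f r \in Q by rewrite -eQ eM in_msetD in_mset1 eqxx orbT.
by rewrite (negbTE (notin _ sQ)).
Qed.

(** The front element never blocks: a marker stands for an unmatched call to a declared procedure,
    [Suspend] always runs, and an [Await] is either resumed or rotated. *)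
Lemma idle_progress sh a q : let c := (sh, (Idle, a :: q)) in
  sinv c -> no_pending_call sh -> exists c', sstep p c c'.
Proof.
move=> c I N; have wfs := sinv_wf I.
have [cI [t [u [s [et eu]]]] sq _ hq] := I; rewrite /= in et eu sq hq wfs.
case: a @c I cI sq hq => [[f r]|m f] c I cI sq hq; last first.
  have [v [h1 h2]] : unmatched sh m f by apply/hq; rewrite mem_cat mem_head orbT.
  case: cI => _ callD _ _.
  have [d md] : exists d, (procs p).[? m] = Some d.
    have /callD mD : CallEv v m f \in core (M_config c).1 by rewrite core_M_trace.
    by exists ((procs p) [` mD]); rewrite in_fnd.
  (* The argument is the value [v] of the unmatched call, which makes the reaction well-formed. *)
  have [w [r' [loc ew]]] := local_proc_ex f m d s v.
  exists (sh ++ w, (Active (Cont f r'), q)); apply: S2 => //; first exact: md.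
  apply: (iffRL (realisesE _ _ _ (@proc_starts_here _ _ _ _))); exists t, s, w; split=> //.
  have wfc : wf (rcons sh (Ev (CallREv v m f))) by apply/wf_rcons.
  apply: wf_eq_core wfc.
  by rewrite core_rcons_Ev core_cat (proc_core_events loc) ew cats1.
case: r @c I cI sq => [|i r] c I cI sq; have /= := sq _ (mem_head _ _) => //.
case: i @c I cI sq => // [|x] c I cI sq _.
  exists (sh ++ [::], (Active (Cont f r), q)); apply: S3 => //.
  apply: (iffRL (realisesE _ _ _ (@stmt_starts_here _ _ _))); exists t, s, [::]; split=> //.
    by rewrite cats0.
  exact: local_suspend.
have [[g sx gc]|nc] := pselect (completed sh s x); last first.
  exists (sh, (Idle, rcons q (QCont (Cont f (Await x :: r))))).
  by apply: (@S4 _ p sh s _ q _ f x r N) => //; rewrite et last_state_rcons.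
exists (sh ++ [:: Ev (CompREv g); St s], (Active (Cont f r), q)); apply: S3 => //.
apply: (iffRL (realisesE _ _ _ (@stmt_starts_here _ _ _))); do 3!eexists; split.
- exact: et.
- by [].
- rewrite -cat1s catA !cats1; apply/wf_rcons; split=> //; apply/wf_rcons; split=> //=.
  by rewrite mem_core.
- exact: local_await.
Qed.

Lemma call_progress c : sinv c -> ~ no_pending_call c.1 -> exists c', sstep p c c'.
Proof.
case: c => sh [act q] [_ [t [u [s [/= et _]]]] _ _ _].
rewrite /no_pending_call /=.
case le : (last_event sh) => [[v m f|? ? ?|?|?|]|] nN; try by case: nN.
exists (t ++ [:: St s; Ev DoneEv; St s], (act, push q (QTask m f))).
apply: S1; first exact: le.
  by rewrite et last_state_rcons.
by rewrite et; apply: Chop.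
Qed.

(** A scheduler stuck while idle has an empty queue, hence no unmatched call. If it is stuck while
    active, [S6] and [S7] leave only nonempty code that is not suspended, and a step of the image
    would yield an [S5] step. *)
Lemma stuck_M c : sinv c -> (forall c', ~ sstep p c c') ->
  forall C', ~ cstep p (M_config c) C'.
Proof.
move=> I stuck C' st.
have [N|nN] := pselect (no_pending_call c.1); last first.
  by have [c' h] := call_progress I nN; apply: stuck h.
case: c I stuck st N => sh [[|[f r]] q] I stuck st /= N.
  case: q I stuck st => [|a q] I stuck st; last first.
    by have [c' h] := idle_progress I N; apply: stuck h.
  have [[f [i [r [//]]]]|[m [f [um _]]]] := idle_cstep I st.
  by have [_ _ _ _ /(_ m f)[_ /(_ um)]] := I; rewrite /= (pending_nil N).
case er : r => [|i r0].
  by subst r; apply: (stuck (sh, (Idle, q))); apply: S6.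
have [sr|nsr] := boolP (suspended r).
  by apply: (stuck _ (@S7 _ p sh q f r N sr)).
have [|sh' [r' re]] := active_cstep I nsr _ st; first by rewrite er.
by apply: (stuck _ (@S5 _ p sh sh' q f r r' N nsr re)).
Qed.

(** * Evolution of the queue and of the activity *)

Definition pops c : Prop := c.2.1 = Idle /\ no_pending_call c.1.

Lemma pops_queue c c' : sstep p c c' -> pops c ->
  exists a q sfx, c.2.2 = a :: q /\ c'.2.2 = q ++ sfx.
Proof.
case: c => sh [act q] st [/= ea N]; subst act.
case: q st => [|a q] st.
  move ec : (sh, (Idle, [::])) st => c st; case: st ec => //=.
  - by move=> sh1 sh' s1 act q1 v m g le _ _ [e1 _ _]; move: le; rewrite -e1 => /N.
  - by move=> sh1 sh' q1 q' m f d r' _ + _ _ [_ eq]; rewrite -eq.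
  - by move=> sh1 sh' q1 q' f r r' _ + _ [_ eq]; rewrite -eq.
  - by move=> sh1 s q1 q' q'' f x r _ _ + _ _ [_ eq]; rewrite -eq.
exists a, q; case: a st => [[f r]|m f] st; have := pop_inv N st.
  case=> [[sh' [r' [_ ->]]]|[x [r0 [s [_ _ _ ->]]]]].
    by exists [::]; rewrite cats0.
  by exists [:: QCont (Cont f r)]; rewrite cats1.
by case=> d [sh' [r' [_ _ ->]]]; exists [::]; rewrite cats0.
Qed.

Lemma not_pops_queue c c' : sstep p c c' -> ~ pops c -> exists sfx, c'.2.2 = c.2.2 ++ sfx.
Proof.
case=> {c c'}.
- by move=> sh sh' s act q v m f *; exists [:: QTask m f]; rewrite /= /push cats1.
- by move=> sh sh' q q' m f d r' N _ _ _ [].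
- by move=> sh sh' q q' f r r' N _ _ [].
- by move=> sh s q q' q'' f x r N _ _ _ _ [].
- by move=> sh sh' q *; exists [::]; rewrite cats0.
- by move=> sh q *; exists [::]; rewrite cats0.
- by move=> sh q f r *; exists [:: QCont (Cont f r)]; rewrite /= /push cats1.
Qed.

(** A pending call forces [S1], whose [DoneEv] becomes the last event, so two such steps never
    follow each other. *)
Lemma call_step c c' : sstep p c c' -> ~ no_pending_call c.1 ->
  [/\ c'.2.1 = c.2.1, no_pending_call c'.1 & ~~ real c c'].
Proof.
case=> {c c'} //=; move=> sh sh' s act q v m f _ ls ch _.
split=> //; last by rewrite /real /= size_rcons ltnn andbF.
by move=> v' m' f'; rewrite (S1_trace ls ch) last_event_cat.
Qed.

(** [S6] and [S7] make the scheduler idle, so remaining active means an [S5] step of code that is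
    not suspended. *)
Lemma active_step c c' : sstep p c c' -> no_pending_call c.1 ->
  c.2.1 <> Idle -> c'.2.1 <> Idle -> real c c' /\ ~ quiescent (M_config c).
Proof.
case=> {c c'} //=.
  by move=> sh sh' s act q v m f le _ _ /(_ v m f).
move=> sh sh' q f r r' _ nsr re _ _ _; split; first by rewrite /real /= leqnn.
have [t [s [w [_ _ _ loc]]]] := iffLR (realisesE _ _ _ (@stmt_starts_here _ _ _)) re.
have [i [r0 [_ [er _ _ _ _]]]] := local_stmt_inv loc.
have inM : Cont f r \in M_sched (Active (Cont f r), q).
  by rewrite /M_sched /= kontE in_msetD mem_seq_mset er mem_head orbT.
by move=> /(_ _ inM); apply/negP.
Qed.

Lemma idle_quiescent c : sinv c -> c.2.1 = Idle -> quiescent (M_config c).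
Proof.
case: c => sh [act q] [_ _ sq _ _] /= ->.
exact: queue_suspended.
Qed.

End Invariant.

(** * Executions *)

Section Stuttering.
Context {C D : Type}.
Variables (tr : C -> D) (step : D -> D -> Prop) (e : execution C) (moves : nat -> bool).
Hypothesis e_moves : forall i, has_stage e i.+1 ->
  if moves i then step (tr (e i)) (tr (e i.+1)) else tr (e i) = tr (e i.+1).

(** The stage of the collapsed execution to which stage [i] of [e] is sent. *)
Definition moves_before (i : nat) : nat := count moves (iota 0 i).

Lemma moves_beforeS i : moves_before i.+1 = moves_before i + moves i.
Proof. by rewrite /moves_before -addn1 iotaD count_cat /= addn0. Qed.

Lemma moves_before_homo : {homo moves_before : i j / i <= j}.
Proof.
move=> i j /subnK <-; elim: (j - i) => // n IH.
by rewrite addSn moves_beforeS (leq_trans IH) // leq_addr.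
Qed.

Lemma has_stage_le i j : i <= j -> has_stage e j -> has_stage e i.
Proof. by rewrite /has_stage; case: last_stage => // n; apply: leq_trans. Qed.

Lemma moves_before_last i n : moves_before i = n.+1 ->
  exists j, [/\ j < i, moves_before j = n & moves j].
Proof.
elim: i => // i IH; rewrite moves_beforeS; case mi : (moves i); rewrite ?addn0 ?addn1.
  by case=> en; exists i.
by move/IH=> [j [ji hn hj]]; exists j; rewrite ltnS (ltnW ji).
Qed.

(** The count starts at 0 and grows by at most one per step, so it skips no value. *)
Lemma moves_before_ivt i n : n <= moves_before i -> exists2 j, j <= i & moves_before j = n.
Proof.
elim: i => [|i IH]; first by rewrite leqn0 => /eqP->; exists 0.
rewrite moves_beforeS leq_eqVlt => /orP[/eqP->|h].
  by exists i.+1; rewrite ?moves_beforeS.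
have [|j ji <-] := IH; first by move: h; case: (moves i); lia.
by exists j => //; apply: leqW.
Qed.

Lemma moves_before_tr i j : has_stage e i -> has_stage e j ->
  moves_before i = moves_before j -> tr (e i) = tr (e j).
Proof.
wlog ij : i j / i <= j => [th hi hj eij|].
  by case/orP: (leq_total i j) => ?; [|symmetry]; apply: th.
move=> hi; move: ij => /subnK <-; elim: (j - i) => // n IH hj.
rewrite addSn moves_beforeS => ecnt.
have hj' : has_stage e (n + i) by apply: has_stage_le hj.
have h1 : moves_before i <= moves_before (n + i) by apply: moves_before_homo; apply: leq_addl.
rewrite IH //; last by move: ecnt h1; lia.
have := e_moves hj; case: ifP => // mv; move: ecnt h1; rewrite mv; lia.
Qed.

Lemma collapse : exists d : execution D,
  [/\ is_execution step (tr (e 0)) d,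
      forall i, has_stage e i ->
        has_stage d (moves_before i) /\ d (moves_before i) = tr (e i)
    & forall n, has_stage d n -> exists2 i, has_stage e i & moves_before i = n].
Proof.
have e0 : has_stage e 0 by rewrite /has_stage; case: last_stage.
pose at_stage n d := exists i, [/\ has_stage e i, moves_before i = n & tr (e i) = d].
have [st hst] : exists st : nat -> D, forall n, (exists d, at_stage n d) -> at_stage n (st n).
  (* Stage [n] is the common image of the stages with count [n]; [tr (e 0)] is a default for counts
     never reached. *)
  have /choice[st h] : forall n, exists d, (exists d, at_stage n d) -> at_stage n d.
    move=> n; have [[d h]|nh] := pselect (exists d, at_stage n d); first by exists d.
    by exists (tr (e 0)).
  by exists st.
have stE i : has_stage e i -> st (moves_before i) = tr (e i).
  move=> hi; have [|j [hj eij <-]] := hst (moves_before i); first by exists (tr (e i)), i.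
  exact: moves_before_tr.
(* A stage of maximal count gives the last stage of [d], also when [e] is infinite and stutters from
   there on; without such a stage the counts are unbounded. *)
pose is_last i := has_stage e i /\ forall j, has_stage e j -> moves_before j <= moves_before i.
have [lst hlst] : exists lst : option nat,
    forall n, has_stage (Execution st lst) n <-> exists2 i, has_stage e i & moves_before i = n.
  have [[i [hi hmax]]|nmax] := pselect (exists i, is_last i).
    exists (Some (moves_before i)) => n; rewrite /has_stage /=; split.
      by case/moves_before_ivt=> j ji <-; exists j => //; apply: has_stage_le hi.
    by case=> j hj <-; apply: hmax.
  exists None => n; split=> // _.
  suff [i hi ni] : exists2 i, has_stage e i & n <= moves_before i.
    by have [j ji <-] := moves_before_ivt ni; exists j => //; apply: has_stage_le hi.
  elim: n => [|n [i hi ni]]; first by exists 0.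
  apply: contrapT => no; apply: nmax; exists i; split=> // j hj.
  rewrite leqNgt; apply/negP=> ij; apply: no; exists j => //; exact: leq_ltn_trans ij.
exists (Execution st lst); split.
- split=> [|n /hlst[i hi /moves_before_last[j [ji ej mj]]]]; first exact: (stE 0).
  have hj1 : has_stage e j.+1 by apply: has_stage_le hi.
  have := e_moves hj1; rewrite mj /= -(stE _ (has_stage_le (leqnSn j) hj1)) -(stE _ hj1).
  by rewrite moves_beforeS mj ej addn1.
- by move=> i hi; split; [apply/hlst; exists i | exact: stE].
- by move=> n /hlst.
Qed.

End Stuttering.

(** * Fairness and completeness of the collapsed execution *)

Section Executions.
Context {L : exprLang} (p : @program L) (finit : tid L).
Hypothesis p_wf : wf_program p.
Hypothesis p_local : no_infinite_local_computation p finit.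
Variable e : execution (@sconfig L).
Hypothesis e_exec : is_execution (sstep p) (sinit p finit) e.

Lemma e_sinv i : has_stage e i -> sinv p (e i).
Proof.
case: e_exec => e0 st; elim: i => [_|i IH hi]; first by rewrite e0; apply: sinv_init.
by apply: (sinv_step p_wf (IH _) (st _ hi)); apply: has_stage_le hi.
Qed.

Definition moves i := real (e i) (e i.+1).
Notation cnt := (moves_before moves).

Lemma e_moves i : has_stage e i.+1 ->
  if moves i then cstep p (M_config (e i)) (M_config (e i.+1))
  else M_config (e i) = M_config (e i.+1).
Proof.
case: e_exec => _ st hi; apply: sstep_sim (st _ hi).
by apply: e_sinv; apply: has_stage_le hi.
Qed.

Variable d : execution (@cconfig L).
Hypothesis d_exec : is_execution (cstep p) (M_config (e 0)) d.
Hypothesis d_stage : forall i, has_stage e i ->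
  has_stage d (cnt i) /\ d (cnt i) = M_config (e i).
Hypothesis d_from_e : forall n, has_stage d n -> exists2 i, has_stage e i & cnt i = n.

Section Infinite.
Hypothesis e_inf : infinite e.

Lemma e_has i : has_stage e i.
Proof. by rewrite /has_stage e_inf. Qed.

Lemma e_step i : sstep p (e i) (e i.+1).
Proof. by case: e_exec => _; apply; apply: e_has. Qed.

(** If the scheduler stayed active from stage [i] on, any two consecutive steps would contain a move
    and no image would be quiescent; [d] would then be infinite and contradict [p_local]. *)
Lemma infinitely_often_idle i : exists2 j, i <= j & (e j).2.1 = Idle.
Proof.
apply: contrapT => no.
have act j : i <= j -> (e j).2.1 <> Idle by move=> ij ej; apply: no; exists j.
have no_call j : i <= j -> no_pending_call (e j).1 ->
    moves j /\ ~ quiescent (M_config (e j)).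
  by move=> ij N; apply: active_step (e_step j) N (act _ ij) (act _ (leqW ij)).
have call j : ~ no_pending_call (e j).1 -> no_pending_call (e j.+1).1 /\ ~~ moves j.
  by case/(call_step (e_step j)).
(* At a pending call [S1] leaves the image unchanged, so the next stage decides. *)
have nq j : i <= j -> ~ quiescent (M_config (e j)).
  move=> ij; have [/(no_call j ij)[]//|/call[N nm]] := pselect (no_pending_call (e j).1).
  have := e_moves (e_has j.+1); rewrite (negbTE nm) => ->.
  by case: (no_call j.+1 (leqW ij) N).
have grows j : i <= j -> cnt j < cnt j.+2.
  move=> ij; rewrite !moves_beforeS.
  have [/(no_call j ij)[-> _]|/call[N nm]] := pselect (no_pending_call (e j).1); first lia.
  by have [-> _] := no_call j.+1 (leqW ij) N; lia.
have unbounded n : exists2 j, i <= j & n <= cnt j.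
  elim: n => [|n [j ij nj]]; first by exists i.
  by exists j.+2; [lia | apply: leq_ltn_trans (grows j ij)].
have d_inf : infinite d.
  rewrite /infinite; case E : (last_stage d) => [n|] //.
  have [j ij nj] := unbounded n.+1; have [hd _] := d_stage (e_has j).
  by move: hd; rewrite /has_stage E; lia.
have d_init : is_execution (cstep p) (cinit p finit) d.
  by case: e_exec d_exec => -> _; rewrite M_config_sinit.
have [n hn qn] := p_local d_init d_inf (cnt i).
have hd : has_stage d n by rewrite /has_stage d_inf.
(* The quiescent stage of [d] is the image of a stage of [e], which lies after [i] because its count
   exceeds [cnt i]. *)
have [j _ ej] := d_from_e hd.
have ij : i <= j.
  by rewrite leqNgt; apply/negP=> /ltnW/(moves_before_homo moves); rewrite ej; lia.
by apply: (nq j ij); have [_ <-] := d_stage (e_has j); rewrite ej.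
Qed.

Lemma infinitely_often_pops i : exists2 j, i <= j & pops (e j).
Proof.
have [j ij ej] := infinitely_often_idle i.
have [N|nN] := pselect (no_pending_call (e j).1); first by exists j.
have [ea N _] := call_step (e_step j) nN.
by exists j.+1; [apply: leqW | split; rewrite ?ea].
Qed.

(** The witness is the first popping stage from [i] on; until then elements are only added at the
    rear. *)
Lemma next_pops i : exists j sfx,
  [/\ i <= j, pops (e j) & (e j).2.2 = (e i).2.2 ++ sfx].
Proof.
have [j0 ij0 pj0] := infinitely_often_pops i.
have [n en] : exists n, j0 = n + i by exists (j0 - i); rewrite subnK.
elim: n i j0 {ij0} en pj0 => [|n IH] i j0 -> pj0.
  by exists i, [::]; rewrite cats0.
have [pi|npi] := pselect (pops (e i)); first by exists i, [::]; rewrite cats0.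
have [|j [sfx [ij pj ej]]] := IH i.+1 _ erefl; first by rewrite addnS.
have [sfx' es] := not_pops_queue (e_step i) npi.
by exists j, (sfx' ++ sfx); split=> //; [apply: ltnW | rewrite ej es catA].
Qed.

(** Induction on the number of elements in front of [a]: each pop removes one of them, and whatever
    enters the queue enters behind [a]. *)
Lemma eventually_popped i a : a \in (e i).2.2 ->
  exists j sh q, [/\ i <= j, no_pending_call sh & e j = (sh, (Idle, a :: q))].
Proof.
move=> ai; have {ai} [q1 [q2 eq]] : exists q1 q2, (e i).2.2 = q1 ++ a :: q2.
  by case/splitPr: ai => q1 q2; exists q1, q2.
elim: q1 i q2 eq => [|b q1 IH] i q2 eq; have [j [sfx [ij pj ej]]] := next_pops i.
  case: pj ej; case ec : (e j) => [sh [act q]] /= ea N eq'; subst act.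
  by exists j, sh, (q2 ++ sfx); rewrite ec eq' eq.
have [b' [q [sfx' [eq1 eq2]]]] := pops_queue (e_step j) pj.
have eq' : q = q1 ++ a :: (q2 ++ sfx).
  by move: eq1; rewrite ej eq /= => -[_ <-]; rewrite -catA.
have [|j' [sh [q' [jj' N ej']]]] := IH j.+1 ((q2 ++ sfx) ++ sfx').
  by rewrite eq2 eq' -[LHS]catA.
by exists j', sh, q'; split=> //; apply: leq_trans jj'; apply: leqW.
Qed.

Lemma call_popped i m f : pops (e i) -> unmatched (e i).1 m f ->
  exists j, [/\ i <= j, moves j & reacted (e j.+1).1 f].
Proof.
move=> [_ N] um; have I := e_sinv (e_has i).
have /eventually_popped[j [sh [q [ij N' ej]]]] : QTask m f \in (e i).2.2.
  have [_ _ _ _ /(_ m f)[_ /(_ um)]] := I.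
  by rewrite (pending_nil N) mem_tasks.
have := e_sinv (e_has j); have := e_step j; rewrite ej => st I'.
have [mv re] := pop_task I' N' st.
by exists j; split=> //; rewrite /moves ej.
Qed.

Lemma reacted_le i j f : i <= j -> reacted (e i).1 f -> reacted (e j).1 f.
Proof.
move=> /subnK <- re; elim: (j - i) => // n [v [m h]].
by exists v, m; rewrite addSn; apply: (sstep_core (e_sinv (e_has _)) (e_step _)).
Qed.

(** Readiness depends only on the last state and the completion events, and both survive in the
    image. *)
Lemma ready_M i j (x : @instr L) : M_config (e i) = M_config (e j) ->
  ready (e i).1 x -> ready (e j).1 x.
Proof.
case=> eM _ rdy y ey; have [s ls [f sy fi]] := rdy y ey.
have [_ [t [u [s1 [et eu]]]] _ _ _] := e_sinv (e_has i).
have [_ [t' [u' [s2 [et' eu']]]] _ _ _] := e_sinv (e_has j).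
have /rcons_inj[_ [es]] := etrans (esym eu) (etrans eM eu').
exists s; first by move: ls; rewrite et et' !last_state_rcons es.
exists f => //; move: fi; rewrite -!mem_core //.
by rewrite -(core_M_trace (e i).1) eM core_M_trace.
Qed.

Lemma d_quiescent_fair : quiescent_fair p d.
Proof.
move=> d_inf m [f r] en.
(* From [i0] on all counts exceed [m], so moves made there are late enough for fairness. *)
have [i0 _ ei0] : exists2 i, has_stage e i & cnt i = m.+1.
  by apply: d_from_e; rewrite /has_stage d_inf.
have d_e i : d (cnt i) = M_config (e i) by case: (d_stage (e_has i)).
have late i : i0 <= i -> m < cnt i by move/(moves_before_homo moves); rewrite ei0.
have {}en i : i0 <= i -> (e i).2.1 = Idle -> enabled p (M_config (e i)) (Cont f r).
  move=> ii ei; rewrite -d_e; apply: en (late _ ii) _; rewrite d_e.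
  exact: idle_quiescent (e_sinv (e_has i)) ei.
have fired i : i0 <= i -> moves i ->
    Cont f r \in new_stmt (M_config (e i)) (M_config (e i.+1)) ->
    exists2 n, m < n & Cont f r \in new_stmt (d n) (d n.+1).
  move=> ii mi ki; exists (cnt i); first exact: late.
  suff -> : (cnt i).+1 = cnt i.+1 by rewrite !d_e.
  by rewrite moves_beforeS mi addn1.
(* When [Cont f (x :: r)] reaches the front, [Cont f r] is enabled, so it has a ready source in the
   queue; by uniqueness this is the front element, which [S3] then resumes. *)
have from_cont i x : i0 <= i -> r <> [::] -> QCont (Cont f (x :: r)) \in (e i).2.2 ->
    exists2 n, m < n & Cont f r \in new_stmt (d n) (d n.+1).
  move=> ii r0 /eventually_popped[j [sh [q [ij N ej]]]].
  have ij0 := leq_trans ii ij.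
  have I := e_sinv (e_has j); have st := e_step j.
  have [C' stC kC] : enabled p (M_config (e j)) (Cont f r) by apply: en; rewrite ?ej.
  rewrite ej in I st stC kC.
  case: (idle_cstep I stC) => [[f' [y [r' [inq rdy /(_ _ kC)[[ef er] _]]]]]|].
    subst f' r'; have exy := source_unique I r0 (mem_head _ _) inq; subst y.
    have [mv /(_ r0) kn] := pop_cont I N rdy st.
    by apply: (fired j); rewrite ?/moves ?ej.
  (* The other origin, an unmatched call, is impossible: [r] would contain a [Return], so the queued
     task [f] would have reacted already. *)
  case=> m' [f' [um /(_ _ kC)[/= ef hr]]]; subst f'.
  case: (reacted_not_unmatched (sinv_wf I) _ um).
  by apply: (return_reacted I (mem_head _ _)); rewrite /has_return /= -/(has_return r) hr orbT.
have [i1 ii1 pi1] := infinitely_often_pops i0.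
have idle i : pops (e i) -> e i = ((e i).1, (Idle, (e i).2.2)).
  by case: (e i) => sh [act q] [/= -> _].
have source i : i0 <= i -> pops (e i) ->
    (exists2 n, m < n & Cont f r \in new_stmt (d n) (d n.+1)) \/
    exists m', unmatched (e i).1 m' f.
  move=> ii pi; have [C' stC kC] := en i ii (proj1 pi).
  have I := e_sinv (e_has i); rewrite (idle _ pi) in I stC kC.
  case: (idle_cstep I stC) => [[f' [y [r' [inq _ /(_ _ kC)[[ef er] r0]]]]]|].
    by subst f' r'; left; apply: (from_cont i y).
  by case=> m' [f' [um /(_ _ kC)[/= ef _]]]; subst f'; right; exists m'.
(* If the origin is an unmatched call, its marker is eventually popped and [f] reacts; at a later
   pop only a queued source is left. *)
case: (source _ ii1 pi1) => // -[m1 um1].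
have [j [ij _ re]] := call_popped pi1 um1.
have [i2 ji2 pi2] := infinitely_often_pops j.+1.
have ii2 : i0 <= i2 by lia.
case: (source _ ii2 pi2) => // -[m2 um2].
by case: (reacted_not_unmatched (sinv_wf (e_sinv (e_has i2))) (reacted_le ji2 re) um2).
Qed.

(** If [d] ends, its last configuration is the image of all late stages of [e]. A transition from it
    would come from a ready queue element or an unmatched call; these persist until popped, and the
    pop would be a further move. *)
Lemma d_complete_infinite : complete (cstep p) d.
Proof.
move=> n ed C' stC.
have [i0 _ ei0] : exists2 i, has_stage e i & cnt i = n.
  by apply: d_from_e; rewrite /has_stage ed.
have bound i : cnt i <= n.
  by have [h _] := d_stage (e_has i); move: h; rewrite /has_stage ed.
have cnt_n i : i0 <= i -> cnt i = n.
  by move/(moves_before_homo moves); rewrite ei0 => h; apply/eqP; rewrite eqn_leq bound.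
have still i : i0 <= i -> ~~ moves i.
  move=> ii; apply/negP=> mi; have := cnt_n i.+1 (leqW ii).
  by rewrite moves_beforeS (cnt_n i ii) mi; lia.
have d_e i : i0 <= i -> d n = M_config (e i).
  by move=> ii; rewrite -(cnt_n i ii); case: (d_stage (e_has i)).
have [i ii pi] := infinitely_often_pops i0.
have I := e_sinv (e_has i).
have ei : e i = ((e i).1, (Idle, (e i).2.2)) by case: (e i) pi => sh [act q] [/= -> _].
have I' := I; rewrite (d_e i ii) in stC; rewrite ei in I' stC.
case: (idle_cstep I' stC) => [[f [x [r [inq rdy _]]]]|[m [f [um _]]]].
  have [j [sh [q [ij N ej]]]] := eventually_popped inq.
  have ij0 := leq_trans ii ij.
  have rdy' : ready (e j).1 x by apply: ready_M rdy; rewrite -!d_e.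
  have := e_sinv (e_has j); have := e_step j; rewrite ej in rdy' *; move=> st I2.
  have [mv _] := pop_cont I2 N rdy' st.
  by move/negP: (still j ij0); rewrite /moves ej.
have [j [ij mj _]] := call_popped pi um.
by have := still j (leq_trans ii ij); rewrite mj.
Qed.

End Infinite.

Lemma d_complete : complete (sstep p) e -> complete (cstep p) d.
Proof.
move=> ce; case E : (last_stage e) => [N|]; last exact: d_complete_infinite.
move=> n ed.
have hN : has_stage e N by rewrite /has_stage E.
(* The last stage of [e] has the largest count, so its image is the last configuration of [d]. *)
have [hd ->] : has_stage d (cnt N) /\ d n = M_config (e N).
  have [hd dN] := d_stage hN; split=> //; rewrite -dN; congr (d _).
  have [|i hi ei] := d_from_e (n := n); first by rewrite /has_stage ed.
  have iN : i <= N by move: hi; rewrite /has_stage E.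
  have := moves_before_homo moves iN; move: hd; rewrite /has_stage ed ei.
  by move=> h1 h2; apply/eqP; rewrite eqn_leq h1 h2.
exact: stuck_M (e_sinv hN) (ce _ E).
Qed.

End Executions.

Theorem theorem2 (L : exprLang) (p : @program L) (finit : tid L)
    (p_wf : wf_program p)
    (p_local : no_infinite_local_computation p finit)
    (e : execution (@sconfig L))
    (e_exec : is_execution (sstep p) (sinit p finit) e) :
  exists d : execution (@cconfig L),
    is_execution (cstep p) (cinit p finit) d /\
    quiescent_fair p d /\
    passes_through (@M_config L) e d /\
    (complete (sstep p) e -> complete (cstep p) d).
Proof.
have [d [d_exec d_stage d_from_e]] := collapse (e_moves p_wf e_exec).
exists d; split; first by case: e_exec d_exec => -> _; rewrite M_config_sinit.
split; last split.
- case E : (last_stage e) => [N|].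
    move=> d_inf.
    (* For finite [e] no count exceeds that of the last stage [N], whereas an infinite [d] would
       have one more stage to account for. *)
    have [i hi ei] : exists2 i, has_stage e i &
        moves_before (moves e) i = (moves_before (moves e) N).+1.
      by apply: d_from_e; rewrite /has_stage d_inf.
    have iN : i <= N by move: hi; rewrite /has_stage E.
    by have := moves_before_homo (moves e) iN; rewrite ei ltnn.
  exact: (d_quiescent_fair p_wf p_local e_exec d_exec d_stage d_from_e E).
- exists (moves_before (moves e)); split=> //.
  + by move=> i _; apply: moves_before_homo.
  + by move=> j /d_from_e[i hi <-]; exists i.
- exact: (d_complete p_wf p_local e_exec d_exec d_stage d_from_e).
Qed.
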